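(* Let $d\ge3$, $\delta>0$, and let $V,W:\mathbb R^d\to\mathbb R$ be twice differentiable functions such that: $\mathrm{Hess}(V)\ge\lambda_VI_d$ and $\mathrm{Hess}(W)\ge\lambda_WI_d$ for some $\lambda_V,\lambda_W\in\mathbb R$; $\nabla V$ is $C_V$-Lipschitz and $\nabla W$ is $C_W$-Lipschitz; and $W$ is even. Let $K^\delta_\eta(x,\cdot)=\mathcal N\big(x-\delta\nabla V(x)-\delta\,\nabla W*\eta(x),\,2\delta I_d\big)$. Then $$\tau_1(K^\delta_\bullet)\le\sqrt{1-2\delta(\lambda_V+\lambda_W)+\delta^2(C_V+C_W)^2}+\sqrt2\,\delta C_W<\infty.$$ Moreover, let $(\eta_n)_{n\ge0}$ and $(X^1_n,\dots,X^N_n)_{n\ge0}$ be the mean-field and particle dynamics for $K^\delta_\bullet$ with initial law $\eta_0$. If $\mathbf E[\|X^1_0\|^2]<\infty$, then there are constants $M^{(2)}_n$, independent of $N$, such that $\mathbf E[\|X^1_n\|^2]\le M^{(2)}_n$ for every $n\ge0$ and, for all $n\ge1$, $N\ge1$ and $q\in\{1,\dots,N\}$, with $\eta^{N,q}_n=\mathrm{Law}(X^1_n,\dots,X^q_n)$, $$\mathbf W_1(\eta^{N,q}_n,\eta_n^{\otimes q})\le C_{2,d}\,\frac{q}{N^{1/d}}\sum_{k=0}^n\big(M^{(2)}_k\big)^{1/2}\,\tau_1(K^\delta_\bullet)^{n-k},$$ where $C_{2,d}$ depends only on $d$. If, additionally, $\lambda_V,\lambda_W,C_V,C_W,\delta$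 are such that $\tau_1(K^\delta_\bullet)<1$ and $a+b<1$, where $$a=1+\delta\big(2-2(\lambda_V+\lambda_W)\big)+4\delta^2(C_V^2+C_W^2),\qquad b=\delta(2+4\delta)C_W^2$$ (in particular $\lambda_V+\lambda_W>0$), then this propagation of chaos is uniform in $n$: there is a constant $C'$ independent of $n,N,q$ such that $\mathbf W_1(\eta^{N,q}_n,\eta_n^{\otimes q})\le C'q/N^{1/d}$ for all such $n,N,q$.
   Context: $\mathcal P_1(\mathbb R^d)$ is the set of Borel probability measures on $\mathbb R^d$ with finite first moment; $\mathbf W_1$ is the 1-Wasserstein distance for the Euclidean norm; on $(\mathbb R^d)^q$ the norm used is $\|(x^1,\dots,x^q)\|=(\sum_i\|x^i\|^2)^{1/2}$. $\mathcal N(m,\Sigma)$ is the $d$-dimensional Gaussian law; $\nabla W*\eta(x)=\int\nabla W(x-z)\,\eta(dz)$; $\mu K(dy)=\int\mu(dx)K(x,dy)$; $$\tau_1(K^\delta_\bullet)=\sup_{\mu\ne\nu\in\mathcal P_1(\mathbb R^d)}\frac{\mathbf W_1(\mu K^\delta_\mu,\nu K^\delta_\nu)}{\mathbf W_1(\mu,\nu)}.$$ Mean-field dynamics: $\eta_{n+1}=\eta_nK^\delta_{\eta_n}$ (the Euler–Maruyama scheme with step $\delta$ for the McKean–Vlasov SDE). Particle dynamics: $X^1_0,\dots,X^N_0$ are i.i.d. with law $\eta_0$; given the particles up to time $n$, the variables $X^1_{n+1},\dots,X^N_{n+1}$ are conditionally independent with $X^i_{n+1}\sim K^\delta_{\eta^N_n}(X^i_n,\cdot)$,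 where $\eta^N_n=\frac1N\sum_{i=1}^N\delta_{X^i_n}$. *)

(* Defs.v *)
From HB Require Import structures.
From mathcomp Require Import all_boot all_order all_algebra.
From mathcomp Require Import all_classical all_reals all_analysis.
From mathcomp Require Import measurable_realfun normal_distribution random_variable.

Set Implicit Arguments.
Unset Strict Implicit.
Unset Printing Implicit Defensive.
Import Order.TTheory GRing.Theory Num.Theory.
Import numFieldNormedType.Exports.

Local Open Scope classical_set_scope.
Local Open Scope ring_scope.

Section borel_matrix.
Context {R : realType} {m n : nat}.

Let mx_borel : set (set 'M[R]_(m, n)) := <<s @open 'M[R]_(m, n) >>.

Let mx_borel0 : mx_borel set0.
Proof. exact: sigma_algebra0. Qed.

Let mx_borelC A : mx_borel A -> mx_borel (~` A).
Proof. exact: sigma_algebraC. Qed.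

Let mx_borel_bigcup (F : (set 'M[R]_(m, n))^nat) :
  (forall i, mx_borel (F i)) -> mx_borel (\bigcup_i F i).
Proof. exact: sigma_algebra_bigcup. Qed.

HB.instance Definition _ := @isMeasurable.Build
  (sigma_display (@open 'M[R]_(m, n))) 'M[R]_(m, n)
  mx_borel mx_borel0 mx_borelC mx_borel_bigcup.

End borel_matrix.

Lemma measurable_fun_mx d (T : measurableType d) (R : realType) m n
    (f : T -> 'M[R]_(m, n)) :
  (forall i j, measurable_fun setT (fun x => f x i j)) -> measurable_fun setT f.
Proof.
move=> mf; apply: (measurability (@open 'M[R]_(m, n))) => //.
move=> _ [U oU <-]; rewrite setTI.
pose c (p : 'M[rat]_(m, n) * nat) : 'M[R]_(m, n) := map_mx ratr p.1.
pose B p : set 'M[R]_(m, n) := ball (c p) p.2.+1%:R^-1.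
pose F p := f @^-1` (if `[< B p `<=` U >] then B p else set0).
have -> : f @^-1` U = \bigcup_p F p.
  apply/seteqP; split => [x /= Ux|x [p _]]; last first.
    by rewrite /F/=; case: asboolP => // + ?; exact.
  have [e /= e0 eU] : exists2 e, 0 < e & ball (f x) e `<=` U.
    by have := open_nbhs_nbhs (conj oU Ux); rewrite -nbhs_ballE => -[e]; exists e.
  have e20 : 0 < e / 2 by rewrite divr_gt0.
  have [k ke] : exists k : nat, k.+1%:R^-1 < e / 2.
    have [k] := ltr_add_invr e20; rewrite add0r; by exists k.
  have k0 : (0 : R) < k.+1%:R^-1 by rewrite invr_gt0.
  have q_ i j : exists q : rat, `|ratr q - f x i j| < k.+1%:R^-1.
    have [q] : exists q, ratr q \in `](f x i j), (f x i j + k.+1%:R^-1)[.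
      by apply: rat_in_itvoo; rewrite ltrDl.
    rewrite in_itv/= => /andP[q1 q2]; exists q.
    by rewrite ger0_norm ?subr_ge0 ?(ltW q1)// ltrBlDl.
  pose Q : 'M[rat]_(m, n) := \matrix_(i, j) sval (cid (q_ i j)).
  have Qx : ball (c (Q, k)) k.+1%:R^-1 (f x).
    split => // i j; rewrite /ball/= !mxE; exact: (svalP (cid (q_ i j))).
  exists (Q, k) => //; rewrite /F/=; case: asboolP => // -[] y Qy.
  apply: eU; apply: (@le_ball _ _ _ (k.+1%:R^-1 + k.+1%:R^-1)).
    by rewrite [leRHS](splitr e) lerD// ltW.
  by apply: ball_triangle Qy; exact: ball_sym.
apply: countable_bigcupT_measurable; first exact: countableP.
move=> p; rewrite /F; case: ifPn => _; last by rewrite preimage_set0.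
have -> : f @^-1` B p =
    \bigcap_(ij in [set: 'I_m * 'I_n])
      (fun x => f x ij.1 ij.2) @^-1` ball (c p ij.1 ij.2) p.2.+1%:R^-1.
  apply/seteqP; split => [x [_ h] [i j] _ /=|x h]; first exact: h.
  by split; [rewrite invr_gt0|move=> i j; exact: (h (i, j) I)].
apply: fin_bigcap_measurable => // -[i j] _ /=.
rewrite -[X in measurable X]setTI; apply: (mf i j) => //.
exact: measurable_ball.
Qed.

Section pow_prob.
Context {d} {T : measurableType d} {R : realType}.

Definition consT n (x : T * n.-tuple T) : n.+1.-tuple T :=
  [the n.+1.-tuple T of x.1 :: x.2].

Let measurable_consT n : measurable_fun setT (@consT n).
Proof. exact: measurable_cons. Qed.

HB.instance Definition _ n := @isMeasurableFun.Build _ _ _ _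
  (@consT n) (@measurable_consT n).

Fixpoint pow_prob (P : probability T R) n : probability (n.-tuple T) R :=
  match n with
  | 0 => dirac ([tuple] : 0.-tuple T)
  | n'.+1 => distribution (P \x pow_prob P n')%E (@consT n')
  end.

End pow_prob.

Section euclidean.
Context {R : realType} {d : nat}.
Implicit Types x y : 'rV[R]_d.

(* The norm `|x| of the library on 'rV[R]_d is the sup norm. *)
Definition enorm x : R := Num.sqrt (\sum_i x 0 i ^+ 2).

Definition edist x y : R := enorm (x - y).

Definition edist_tuple q (x y : q.-tuple 'rV[R]_d) : R :=
  Num.sqrt (\sum_i edist (tnth x i) (tnth y i) ^+ 2).

Definition grad (V : 'rV[R]_d -> R) x : 'rV[R]_d :=
  \row_i 'D_(delta_mx 0 i) V x.

Definition hess (V : 'rV[R]_d -> R) x : 'M[R]_d := jacobian (grad V) x.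

Definition twice_differentiable (V : 'rV[R]_d -> R) : Prop :=
  (forall x, differentiable V x) /\ (forall x, differentiable (grad V) x).

(* A >= l I_d in the Loewner order. *)
Definition mx_ge (A : 'M[R]_d) (l : R) : Prop :=
  forall v : 'rV[R]_d, l * (v *m v^T) 0 0 <= (v *m A *m v^T) 0 0.

Definition elipschitz (C : R) (f : 'rV[R]_d -> 'rV[R]_d) : Prop :=
  forall x y, edist (f x) (f y) <= C * edist x y.

End euclidean.

Section gaussian.
Context {R : realType} {d : nat}.

(* normal_prob lives on measurableTypeR R, which is R with the same measurable
   sets but another display. *)
Definition affine_row (m : 'rV[R]_d) (s : R)
    (z : d.-tuple (measurableTypeR R)) : 'rV[R]_d :=
  m + s *: \row_i (tnth z i : R).

Let measurable_affine_row m s : measurable_fun setT (affine_row m s).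
Proof.
apply: measurable_fun_mx => i j; rewrite ord1.
rewrite (_ : (fun _ => _) = (fun z => m 0 j + s * (tnth z j : R))); last first.
  by apply/funext => z; rewrite !mxE.
apply: measurable_funD => //; apply: measurable_funM => //.
exact: measurable_tnth.
Qed.

HB.instance Definition _ m s := @isMeasurableFun.Build _ _ _ _
  (affine_row m s) (@measurable_affine_row m s).

(* N(m, v I_d) for v >= 0, as the law of m + sqrt v Z with Z a vector of d
   independent N(0, 1) variables. *)
Definition gauss (m : 'rV[R]_d) (v : R) : probability 'rV[R]_d R :=
  distribution (pow_prob (normal_prob 0 1) d) (affine_row m (Num.sqrt v)).

End gaussian.

Section wasserstein.
Local Open Scope ereal_scope.
Context {d} {T : measurableType d} {R : realType}.

Definition coupling (mu nu : set T -> \bar R) (pi : probability (T * T)%type R)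
    : Prop :=
  forall A, measurable A ->
    pi (A `*` setT) = mu A /\ pi (setT `*` A) = nu A.

(* mu and nu are set functions, so that measures such as apply_kernel mu k below
   need not be bundled; only their values on measurable sets matter. *)
Definition W1 (dist : T -> T -> R) (mu nu : set T -> \bar R) : \bar R :=
  ereal_inf [set \int[pi]_z (dist z.1 z.2)%:E | pi in coupling mu nu].

End wasserstein.

Section mean_field.
Local Open Scope ereal_scope.
Context {d} {T : measurableType d} {R : realType}.
Implicit Types (mu : {measure set T -> \bar R}).

(* A family (K_eta)_eta of Markov kernels; eta ranges over all measures so that
   it can be the empirical measure below. *)
Definition kernel_family := {measure set T -> \bar R} -> T -> probability T R.

Definition apply_kernel mu (k : T -> probability T R) : set T -> \bar R :=
  fun A => \int[mu]_x k x A.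

Definition mean_field_dynamics (K : kernel_family) (eta : nat -> probability T R)
    : Prop :=
  forall n A, measurable A -> eta n.+1 A = apply_kernel (eta n) (K (eta n)) A.

Definition empirical N (x : N.-tuple T) : {measure set T -> \bar R} :=
  mscale (N%:R^-1%:nng)%R (msum (fun i => \d_(nth point x i)) N).

Section particles.
Context d' (Omega : measurableType d') (P : probability Omega R).
Context (N : nat) (X : nat -> 'I_N -> {RV P >-> T}).

Definition config n (w : Omega) : N.-tuple T := [tuple X n i w | i < N].

Definition history n : set (set Omega) :=
  <<s [set A | exists k i B,
         [/\ (k <= n)%N, measurable B & A = X k i @^-1` B]] >>.

(* The last clause says that, conditionally on the history up to time n, the
   X n.+1 i are independent with laws K (empirical (config n)) (X n i). *)
Definition particle_dynamics (K : kernel_family) (eta0 : probability T R)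
    : Prop :=
  (forall B : 'I_N -> set T, (forall i, measurable (B i)) ->
     P (\bigcap_(i in [set: 'I_N]) (X 0%N i @^-1` B i)) =
     \prod_(i < N) eta0 (B i)) /\
  (forall n (H : set Omega) (B : 'I_N -> set T),
     history n H -> (forall i, measurable (B i)) ->
     P (H `&` \bigcap_(i in [set: 'I_N]) (X n.+1 i @^-1` B i)) =
     \int[P]_(w in H) \prod_(i < N) K (empirical (config n w)) (X n i w) (B i)).

Definition first_particles q (hq : (q <= N)%N) n (w : Omega) : q.-tuple T :=
  [tuple X n (widen_ord hq i) w | i < q].

End particles.

End mean_field.

Section euler_maruyama.
Context {R : realType} {d : nat}.
Local Notation Rd := ('rV[R]_d).

Definition finite_first_moment (mu : probability Rd R) : Prop :=
  (\int[mu]_x (enorm x)%:E < +oo)%E.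

(* mu and nu are compared on measurable sets only, since measures are functions
   defined on all sets. *)
Definition tau1 (K : @kernel_family _ Rd R) : \bar R :=
  ereal_sup [set (W1 edist (apply_kernel mu.1 (K mu.1))
                           (apply_kernel mu.2 (K mu.2))
                  / W1 edist mu.1 mu.2)%E
            | mu in [set mu : probability Rd R * probability Rd R |
                [/\ finite_first_moment mu.1, finite_first_moment mu.2 &
                    exists2 A, measurable A & mu.1 A != mu.2 A]]].

Definition grad_conv (W : Rd -> R) (eta : {measure set Rd -> \bar R}) (x : Rd)
    : Rd :=
  \row_i \int[eta]_z grad W (x - z) 0 i.

Definition em_kernel (delta : R) (V W : Rd -> R) : @kernel_family _ Rd R :=
  fun eta x =>
    gauss (x - delta *: grad V x - delta *: grad_conv W eta x) (2 * delta).

End euler_maruyama.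

(* Main.v *)
(* Sznitman's synchronous coupling. Driving two copies of the Euler-Maruyama step
   by the same Gaussian noise cancels the noise, and monotonicity plus Lipschitz
   continuity of the gradients make the drift contract by
   c = sqrt (1 - 2 delta (lV + lW) + delta^2 (CV + CW)^2) + delta CW; this bounds
   tau1. Driving the particles and N independent mean-field copies Y^i by the same
   noises, started from the same points, the mean distance after n + 1 steps is at
   most c times the one after n steps plus delta times the fluctuation
   |grad W * (eta^N_Y - eta_n)|(Y^i). The latter is O(N^(-1/2)) in L^2 because the
   cross terms of its variance vanish, and N^(-1/2) <= N^(-1/d). Finally, a + b < 1
   forces c < 1, by AM-GM, which makes the moments and the distances bounded
   uniformly in n. *)
Require Import Defs.
From HB Require Import structures.
From mathcomp Require Import all_boot all_order all_algebra.
From mathcomp Require Import all_classical all_reals all_analysis.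
From mathcomp Require Import measurable_realfun normal_distribution random_variable.
From mathcomp Require Import ring lra.
(* [edist] is also a name of the library. *)
Import Defs.

Set Implicit Arguments.
Unset Strict Implicit.
Unset Printing Implicit Defensive.
Import Order.TTheory GRing.Theory Num.Theory.
Import numFieldNormedType.Exports.

Local Open Scope classical_set_scope.
Local Open Scope ring_scope.

(** The particles live on a given space that need not carry the Gaussian noise, so the coupling is
    not built there. It is built on auxiliary product spaces that gain one factor of noise at each
    step, and it is tied to the given particles only through the law of the configuration at the
    current time. This suffices because the next law depends on that configuration alone and [W1]
    sees only laws. The form of c comes from changing one argument at a time in grad W (x - z): with
    z frozen, the displacement x - y is contracted by both Hessian bounds at once; replacing z by z'
    then costs delta CW per unit distance. Second moments enter through the fluctuation term. Their
    recursion is arranged so that its factor is below 1 as soon as c is: the square of an affine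
    bound is estimated by convexity with the weights of that bound, not by a fixed multiple of the
    sum of squares. One sequence then bounds the moments of the mean-field flow and of the
    particles, for every N. *)

(** * Euclidean geometry *)

Section euclidean_norm.
Context {R : realType} {d : nat}.
Implicit Types (x y u v : 'rV[R]_d) (a : R).

Definition dot u v : R := \sum_i u 0 i * v 0 i.

Lemma dotDl u v w : dot (u + v) w = dot u w + dot v w.
Proof. by rewrite /dot -big_split; apply: eq_bigr => i _; rewrite mxE mulrDl. Qed.

Lemma dotZl a u v : dot (a *: u) v = a * dot u v.
Proof. by rewrite /dot mulr_sumr; apply: eq_bigr => i _; rewrite mxE mulrA. Qed.

Lemma dotC u v : dot u v = dot v u.
Proof. by apply: eq_bigr => i _; rewrite mulrC. Qed.

Lemma dotDr u v w : dot u (v + w) = dot u v + dot u w.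
Proof. by rewrite dotC dotDl !(dotC u). Qed.

Lemma dotZr a u v : dot u (a *: v) = a * dot u v.
Proof. by rewrite dotC dotZl dotC. Qed.

Lemma enorm_ge0 x : 0 <= enorm x. Proof. exact: sqrtr_ge0. Qed.
Hint Resolve enorm_ge0 : core.

Lemma enorm_sqr x : enorm x ^+ 2 = dot x x.
Proof.
rewrite sqr_sqrtr; last by apply: sumr_ge0 => i _; exact: sqr_ge0.
by apply: eq_bigr => i _; rewrite expr2.
Qed.

Lemma enorm_eq0 x : enorm x = 0 -> x = 0.
Proof.
move=> /(congr1 (fun t => t ^+ 2)); rewrite enorm_sqr expr0n /= /dot => /eqP.
rewrite psumr_eq0 => [/allP x0|i _]; last by rewrite -expr2 sqr_ge0.
apply/rowP => i; rewrite mxE; have := x0 i (mem_index_enum i).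
by rewrite /= mulf_eq0 orbb => /eqP.
Qed.

Lemma enorm0 : enorm (0 : 'rV[R]_d) = 0.
Proof. by rewrite /enorm big1 ?sqrtr0// => i _; rewrite mxE expr0n. Qed.

Lemma dot_le_enorm u v : dot u v <= enorm u * enorm v.
Proof.
have [/enorm_eq0 ->|u0] := eqVneq (enorm u) 0.
  by rewrite enorm0 mul0r /dot big1// => i _; rewrite mxE mul0r.
have [/enorm_eq0 ->|v0] := eqVneq (enorm v) 0.
  by rewrite enorm0 mulr0 /dot big1// => i _; rewrite mxE mulr0.
have uv0 : 0 < enorm u * enorm v by rewrite mulr_gt0// lt_def ?u0 ?v0/=.
(* This square equals 2 |u| |v| (|u| |v| - u.v). *)
have := sqr_ge0 (enorm (enorm v *: u + (- enorm u) *: v)).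
rewrite enorm_sqr !(dotDl, dotDr, dotZl, dotZr) -!enorm_sqr (dotC v u).
move: uv0; move: (enorm u) (enorm v) (dot u v) => p q r pq0.
rewrite [X in 0 <= X](_ : _ = p * q * ((p * q - r) *+ 2)); last by ring.
by rewrite pmulr_rge0// pmulrn_lge0// subr_ge0.
Qed.

Lemma enormD u v : enorm (u + v) <= enorm u + enorm v.
Proof.
rewrite -(@ler_pXn2r _ 2%N) ?nnegrE ?addr_ge0// enorm_sqr.
rewrite !(dotDl, dotDr) -!enorm_sqr (dotC v u).
have := dot_le_enorm u v; move: (enorm u) (enorm v) (dot u v) => p q r; nra.
Qed.

Lemma enormZ a u : enorm (a *: u) = `|a| * enorm u.
Proof.
rewrite -(sqrtr_sqr a) -sqrtrM ?sqr_ge0//; congr Num.sqrt.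
by rewrite mulr_sumr; apply: eq_bigr => i _; rewrite mxE exprMn.
Qed.

Lemma enormN u : enorm (- u) = enorm u.
Proof. by rewrite -scaleN1r enormZ normrN normr1 mul1r. Qed.

Lemma enormB u v : enorm (u - v) <= enorm u + enorm v.
Proof. by rewrite -(enormN v) enormD. Qed.

Lemma enorm_sum (I : Type) (r : seq I) (F : I -> 'rV[R]_d) :
  enorm (\sum_(i <- r) F i) <= \sum_(i <- r) enorm (F i).
Proof.
elim: r => [|i r ih]; first by rewrite !big_nil enorm0.
by rewrite !big_cons (le_trans (enormD _ _))// lerD2l.
Qed.

Lemma normr_le_enorm x i : `|x 0 i| <= enorm x.
Proof.
rewrite -sqrtr_sqr ler_sqrt ?sqr_ge0//; last first.
  by apply: sumr_ge0 => j _; exact: sqr_ge0.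
by rewrite (bigD1 i)//= lerDl; apply: sumr_ge0 => j _; exact: sqr_ge0.
Qed.

Lemma enorm_le_sum x : enorm x <= \sum_i `|x 0 i|.
Proof.
have x0 : 0 <= \sum_i `|x 0 i| by exact: sumr_ge0.
rewrite -(ger0_norm x0) -sqrtr_sqr ler_sqrt ?sqr_ge0//.
rewrite [leRHS]expr2 mulr_suml; apply: ler_sum => i _.
rewrite -real_normK ?num_real// expr2 ler_wpM2l//.
by rewrite (bigD1 i)//= lerDl; exact: sumr_ge0.
Qed.

Lemma edist_ge0 x y : 0 <= edist x y. Proof. exact: enorm_ge0. Qed.

Lemma edistC x y : edist x y = edist y x.
Proof. by rewrite /edist -enormN opprB. Qed.

Lemma edist_tri z x y : edist x y <= edist x z + edist z y.
Proof. by rewrite /edist -[x - y](subrKA z) enormD. Qed.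

Lemma enorm_dist x y : `|enorm x - enorm y| <= edist x y.
Proof.
have h u v : enorm u - enorm v <= edist u v.
  by rewrite lerBlDr -{1}(subrK v u) enormD.
by rewrite ler_norml h andbT lerNl opprB edistC h.
Qed.

Lemma edist_tuple_le_sum q (x y : q.-tuple 'rV[R]_d) :
  edist_tuple x y <= \sum_(i < q) edist (tnth x i) (tnth y i).
Proof.
have x0 : 0 <= \sum_(i < q) edist (tnth x i) (tnth y i).
  by apply: sumr_ge0 => i _; exact: edist_ge0.
rewrite -(ger0_norm x0) -sqrtr_sqr ler_sqrt ?sqr_ge0//.
rewrite [leRHS]expr2 mulr_suml; apply: ler_sum => i _.
rewrite expr2 ler_wpM2l ?edist_ge0//.
by rewrite (bigD1 i)//= lerDl; apply: sumr_ge0 => j _; exact: edist_ge0.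
Qed.

(** The Borel sets come from the sup norm, whereas the hypothesis uses the Euclidean distance; the
    bridge is that the Euclidean norm is at most the sum of the d absolute coordinates. *)
Lemma lipschitz_measurable (C : R) (g : 'rV[R]_d -> R) :
  (forall x y, `|g x - g y| <= C * edist x y) -> measurable_fun setT g.
Proof.
move=> gC; suff cg : continuous g.
  apply: (measurability _ (RGenOInfty.measurableE R)) => //.
  move=> _ [_ [a ->] <-]; rewrite setTI; apply: sub_sigma_algebra.
  by apply: open_comp => [x _|]; [exact: cg|exact: interval_open].
have {}gC x y : `|g x - g y| <= (`|C| + 1) * edist x y.
  rewrite (le_trans (gC x y))// ler_wpM2r ?edist_ge0//.
  by rewrite (le_trans (ler_norm C))// lerDl.
have C0 : 0 < `|C| + 1 by rewrite ltr_wpDl.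
move=> x; apply/(@cvgrPdist_lt _ _ _ _ (nbhs_filter x)) => e e0.
(* [d.+1] in place of d leaves room for the strict inequality and covers d = 0. *)
pose k : R := (`|C| + 1) * d.+1%:R.
have k0 : 0 < k by rewrite mulr_gt0.
have ek0 : 0 < e / k by rewrite divr_gt0.
apply/nbhs_ballP; exists (e / k) => //= y [_ xy].
have {}xy i : `|(x - y) 0 i| <= e / k by rewrite !mxE ltW// (xy 0 i).
apply: le_lt_trans (gC x y) _.
apply: (@le_lt_trans _ _ ((`|C| + 1) * (e / k *+ d))).
  rewrite ler_wpM2l ?(ltW C0)// (le_trans (enorm_le_sum _))//.
  by rewrite (le_trans (ler_sum _ (fun i _ => xy i)))// sumr_const card_ord.
rewrite [ltRHS](_ : e = (`|C| + 1) * (e / k *+ d.+1)); last first.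
  by rewrite mulrnAr -mulr_natr mulrAC -/k mulrC divfK// gt_eqF.
by rewrite ltr_pM2l// mulrS ltrDr.
Qed.

Lemma measurable_coord i : measurable_fun setT (fun x : 'rV[R]_d => x 0 i).
Proof.
apply: (@lipschitz_measurable 1) => x y.
by rewrite mul1r (le_trans _ (normr_le_enorm _ i))// !mxE.
Qed.

Lemma measurable_enorm : measurable_fun setT (@enorm R d).
Proof.
by apply: (@lipschitz_measurable 1) => x y; rewrite mul1r; exact: enorm_dist.
Qed.

Lemma elipschitz_measurable (C : R) (f : 'rV[R]_d -> 'rV[R]_d) :
  elipschitz C f -> measurable_fun setT f.
Proof.
move=> fC; apply: measurable_fun_mx => i j; rewrite ord1.
apply: (@lipschitz_measurable C) => x y; apply: le_trans (fC x y).
by rewrite (le_trans _ (normr_le_enorm _ j))// !mxE.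
Qed.

Section row_measurable.
Context d' {T : measurableType d'}.
Implicit Types f g : T -> 'rV[R]_d.

Lemma measurable_fun_coord f i :
  measurable_fun setT f -> measurable_fun setT (fun t => f t 0 i).
Proof. by move=> mf; exact: (measurableT_comp (measurable_coord i) mf). Qed.

Lemma measurable_fun_rowD f g : measurable_fun setT f -> measurable_fun setT g ->
  measurable_fun setT (fun t => f t + g t).
Proof.
move=> mf mg; apply: measurable_fun_mx => i j; rewrite ord1.
under eq_fun do rewrite mxE.
by apply: measurable_funD; exact: measurable_fun_coord.
Qed.

Lemma measurable_fun_rowZ a f : measurable_fun setT f ->
  measurable_fun setT (fun t => a *: f t).
Proof.
move=> mf; apply: measurable_fun_mx => i j; rewrite ord1.
under eq_fun do rewrite mxE.
by apply: measurable_funM => //; exact: measurable_fun_coord.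
Qed.

Lemma measurable_fun_rowB f g : measurable_fun setT f -> measurable_fun setT g ->
  measurable_fun setT (fun t => f t - g t).
Proof.
move=> mf mg; rewrite (_ : (fun t => _) = (fun t => f t + (-1) *: g t)).
  by apply: measurable_fun_rowD => //; exact: measurable_fun_rowZ.
by apply/funext => t; rewrite scaleN1r.
Qed.

Lemma measurable_fun_row_sum (I : Type) (s : seq I) (F : I -> T -> 'rV[R]_d) :
  (forall i, measurable_fun setT (F i)) ->
  measurable_fun setT (fun t => \sum_(i <- s) F i t).
Proof.
move=> mF; apply: measurable_fun_mx => i j; rewrite ord1.
under eq_fun do rewrite summxE.
by apply: measurable_sum => k; exact: measurable_fun_coord.
Qed.

Lemma measurable_fun_enorm f : measurable_fun setT f ->
  measurable_fun setT (fun t => enorm (f t)).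
Proof. by move=> mf; exact: (measurableT_comp measurable_enorm mf). Qed.

End row_measurable.

(* The mean value theorem along the segment from y to x. *)
Lemma hess_ge_monotone (V : 'rV[R]_d -> R) (l : R) :
  twice_differentiable V -> (forall x, mx_ge (hess V x) l) ->
  forall x y, l * edist x y ^+ 2 <= dot (x - y) (grad V x - grad V y).
Proof.
move=> [_ dV] hV x y; set v := x - y.
pose p (t : R) := dot v (grad V (y + t *: v)).
pose q (t : R) := 'D_v (grad V) (y + t *: v).
have dp (t : R) : is_derive t 1 p (dot v (q t)).
  have gd : derivable (grad V) (y + t *: v) v by exact: diff_derivable.
  have di i : is_derive t (1 : R) (fun t : R => v 0 i * grad V (y + t *: v) 0 i)
      (v 0 i * q t 0 i).
    have E : (fun h : R => h^-1 *: (grad V (y + (h *: (1 : R) + t) *: v) 0 i -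
                                    grad V (y + t *: v) 0 i)) =
             (fun h : R => h^-1 *: (grad V (h *: v + (y + t *: v)) 0 i -
                                    grad V (y + t *: v) 0 i)).
      apply/funext => h; have -> : h *: (1 : R) = h by exact: mulr1.
      by rewrite scalerDl addrCA.
    have gi : derivable (fun x => grad V x 0 i) (y + t *: v) v.
      by move/derivable_mxP : gd => /(_ 0 i).
    have -> : q t 0 i = 'D_1 (fun t : R => grad V (y + t *: v) 0 i) t.
      by rewrite /q derive_mx// mxE /derive E.
    have : is_derive t (1 : R) (fun t : R => grad V (y + t *: v) 0 i)
        ('D_1 (fun t : R => grad V (y + t *: v) 0 i) t).
      apply: DeriveDef; [rewrite /derivable E; exact: gi|exact: erefl].
    by move=> ?; apply: is_deriveZ.
  rewrite /p /dot.
  rewrite (_ : (fun t => _) = \sum_i (fun t : R => v 0 i * grad V (y + t *: v) 0 i)).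
    by apply: is_derive_sum.
  by apply/funext => s; rewrite fct_sumE.
have [t _] : exists2 t, t \in `](0 : R), 1[ & p 1 - p 0 = dot v (q t) * (1 - 0).
  apply: MVT => //.
  apply: continuous_subspaceT => t; apply: differentiable_continuous.
  by apply/derivable1_diffP; have [] := dp t.
rewrite /p scale1r scale0r addr0 subrKC subr0 mulr1 => pE.
rewrite dotDr -scaleN1r dotZr mulN1r pE.
have := hV (y + t *: v) v.
rewrite /q deriveEjacobian// /edist -/v enorm_sqr.
have E u w : dot u w = (u *m w^T) 0 0.
  by rewrite mxE; apply: eq_bigr => i _; rewrite mxE.
by rewrite E dotC E.
Qed.

End euclidean_norm.

(** * Laws and product measures *)

Section same_law.
Local Open Scope ereal_scope.
Context d1 d2 d3 {E1 : measurableType d1} {E2 : measurableType d2}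
  {T : measurableType d3} {R : realType}.
Context (P1 : probability E1 R) (P2 : probability E2 R).

(** The two variables may live on different spaces: this is what links the auxiliary coupling spaces
    to the given one. *)
Definition same_law (X : E1 -> T) (Y : E2 -> T) : Prop :=
  forall A, measurable A -> P1 (X @^-1` A) = P2 (Y @^-1` A).

(** Positive and negative parts are transported separately, so integrability of f does not come into
    play. *)
Lemma same_law_integral (X : E1 -> T) (Y : E2 -> T) (f : T -> \bar R) :
  measurable_fun setT X -> measurable_fun setT Y -> same_law X Y ->
  measurable_fun setT f -> \int[P1]_e f (X e) = \int[P2]_e f (Y e).
Proof.
move=> mX mY XY.
wlog f0 : f / forall t, 0 <= f t => [h mf|mf].
  rewrite integralE [RHS]integralE.
  rewrite (funepos_comp f X) (funepos_comp f Y) (funeneg_comp f X) (funeneg_comp f Y).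
  by rewrite /comp !h//; [exact: measurable_funeneg|exact: measurable_funepos].
have := @ge0_integral_pushforward _ _ _ _ _ X mX P1 setT f measurableT mf.
rewrite preimage_setT => <-; last by move=> t _; exact: f0.
have := @ge0_integral_pushforward _ _ _ _ _ Y mY P2 setT f measurableT mf.
rewrite preimage_setT => <-; last by move=> t _; exact: f0.
by apply: eq_measure_integral => A mA _; exact: XY.
Qed.

End same_law.

Lemma emeasurable_fun_prod d (T : measurableType d) (R : realType) (I : Type)
    (s : seq I) (g : I -> T -> \bar R) :
  (forall i, measurable_fun setT (g i)) ->
  measurable_fun setT (fun t => \prod_(i <- s) g i t)%E.
Proof.
move=> mg; elim: s => [|i s ih].
  by under eq_fun do rewrite big_nil; exact: measurable_cst.
by under eq_fun do rewrite big_cons; exact: emeasurable_funM.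
Qed.

Section tuple_measure.
Context d {T : measurableType d} {R : realType}.

Definition box n (B : 'I_n -> set T) : set (n.-tuple T) :=
  [set t | forall i, B i (tnth t i)].

Lemma measurable_box n (B : 'I_n -> set T) :
  (forall i, measurable (B i)) -> measurable (box B).
Proof.
move=> mB.
have -> : box B = \bigcap_(i in [set: 'I_n]) ((fun t => tnth t i) @^-1` B i).
  by apply/seteqP; split => [t tB i _|t tB i]; [exact: tB|exact: (tB i I)].
apply: fin_bigcap_measurable => // i _.
by rewrite -[X in measurable X]setTI; exact: measurable_tnth.
Qed.

(** Boxes are stable under intersection and contain the coordinate cylinders, which generate the
    sigma-algebra of tuples. *)
Lemma box_unique n (m1 m2 : probability (n.-tuple T) R) :
  (forall B, (forall i, measurable (B i)) -> m1 (box B) = m2 (box B)) ->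
  forall A, measurable A -> m1 A = m2 A.
Proof.
move=> m12.
pose G := [set box B | B in [set B : 'I_n -> set T | forall i, measurable (B i)]].
have GT : G setT.
  by exists (fun=> setT) => //; apply/seteqP; split.
apply: (measure_unique G (fun=> setT)) => //.
- apply/seteqP; split; last first.
    apply: smallest_sub; first exact: sigma_algebra_measurable.
    by move=> _ [B mB <-]; exact: measurable_box.
  apply: smallest_sub; first exact: smallest_sigma_algebra.
  move=> A; rewrite -bigcup_seq => -[i _ [C mC <-]]; rewrite setTI.
  (* A cylinder is a box whose other sides are full. *)
  apply: sub_sigma_algebra; exists (fun j => if j == i then C else setT).
    by move=> j /=; case: ifP.
  apply/seteqP; split => [t /(_ i)|t /= tC j]; first by rewrite eqxx.
  by case: eqP => // ->.
- move=> _ _ [B mB <-] [C mC <-]; exists (fun i => B i `&` C i).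
    by move=> i; exact: measurableI.
  apply/seteqP; split => [t h|t [hB hC] i].
    by split => i; have [] := h i.
  by split; [exact: hB|exact: hC].
- by apply/seteqP; split => // t _; exists 0%N.
- by move=> _ [B mB <-]; exact: m12.
- by move=> _; rewrite (le_lt_trans (probability_le1 m1 measurableT)) ?ltry.
Qed.

Local Open Scope ereal_scope.

Lemma pow_prob_box (P : probability T R) n (B : 'I_n -> set T) :
  (forall i, measurable (B i)) -> pow_prob P n (box B) = \prod_(i < n) P (B i).
Proof.
elim: n B => [|n ih] B mB.
  rewrite big_ord0 /= diracE mem_set//.
  by move=> [].
rewrite big_ord_recl -[X in _ * X]ih//.
transitivity ((P \x pow_prob P n) (@consT _ T n @^-1` box B)); first by [].
rewrite (_ : _ @^-1` _ = B ord0 `*` box (fun i => B (lift ord0 i))).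
  by rewrite product_measure1E//; exact: measurable_box.
apply/seteqP; split => [[x t] /= h|[x t] /= [h0 h1] i].
  split => [|i /=]; first by have := h ord0; rewrite /consT/= tnth0.
  by have := h (lift ord0 i); rewrite /consT/= tnthS.
rewrite /consT/=; case: (unliftP ord0 i) => [j|] ->.
  by rewrite tnthS; exact: h1.
by rewrite tnth0.
Qed.

(** Tonelli along the nested pairs. It turns one step of N independent copies into a product of N
    one-particle steps. *)
Lemma integral_pow_prob_prod (P : probability T R) n (f : 'I_n -> T -> \bar R) :
  (forall i, measurable_fun setT (f i)) -> (forall i x, 0 <= f i x) ->
  \int[pow_prob P n]_t \prod_(i < n) f i (tnth t i) =
  \prod_(i < n) \int[P]_x f i x.
Proof.
elim: n f => [|n ih] f mf f0.
  rewrite big_ord0; under eq_integral do rewrite big_ord0.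
  by rewrite integral_cst// mul1e; exact: probability_setT.
pose h i x := f (lift ord0 i) x.
have mh : measurable_fun setT (fun t : n.-tuple T => \prod_(i < n) h i (tnth t i)).
  apply: emeasurable_fun_prod => i.
  exact: (measurableT_comp (mf _) (@measurable_tnth _ _ _ i)).
have h0 t : 0 <= \prod_(i < n) h i (tnth t i) by apply: prode_ge0 => i _; exact: f0.
have m0 : measurable_fun setT (f ord0 \o @fst T (n.-tuple T)).
  exact: measurableT_comp.
rewrite big_ord_recl -[X in _ * X]ih//.
rewrite ge0_integral_distribution//; last 2 first.
- apply: emeasurable_fun_prod => i.
  exact: (measurableT_comp (mf _) (@measurable_tnth _ _ _ i)).
- by move=> t; apply: prode_ge0 => i _; exact: f0.
rewrite (eq_integral (fun z : T * n.-tuple T =>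
    f ord0 z.1 * \prod_(i < n) h i (tnth z.2 i))); last first.
  move=> [x t] _; rewrite /= big_ord_recl /consT/= tnth0; congr (_ * _).
  by apply: eq_bigr => i _; rewrite tnthS.
rewrite fubini_tonelli1; last 2 first.
- apply: emeasurable_funM; first exact: m0.
  exact: (measurableT_comp mh (@measurable_snd _ _ T (n.-tuple T))).
- by move=> z; rewrite mule_ge0// f0.
rewrite -ge0_integralZr//; last by apply: integral_ge0 => t _; exact: h0.
apply: eq_integral => x _.
by rewrite /fubini_F/= ge0_integralZl.
Qed.

Lemma pow_prob_coord (P : probability T R) n (i : 'I_n) :
  same_law (pow_prob P n) P (fun t => tnth t i) id.
Proof.
move=> A mA; pose B j := if j == i then A else setT.
have -> : (fun t => tnth t i) @^-1` A = box B.
  apply/seteqP; split => [t tA j|t /(_ i)]; rewrite /B ?eqxx//.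
  by case: eqP => // ->.
rewrite pow_prob_box; last by move=> j; rewrite /B; case: ifP.
rewrite (bigD1 i)//= /B eqxx big1 ?mule1// => j /negPf ->.
exact: probability_setT.
Qed.

Definition set_coord n (l : 'I_n) (z : n.-tuple T * T) : n.-tuple T :=
  [tuple if i == l then z.2 else tnth z.1 i | i < n].

Lemma measurable_set_coord n l : measurable_fun setT (@set_coord n l).
Proof.
apply/measurable_fun_tnthP => i.
rewrite (_ : _ \o _ = if i == l then snd else (fun t => tnth t i) \o fst).
  case: ifP => // _.
  by apply: measurableT_comp => //; exact: measurable_tnth.
by apply/funext => z /=; rewrite tnth_mktuple; case: ifP.
Qed.

HB.instance Definition _ n l := @isMeasurableFun.Build _ _ _ _
  (@set_coord n l) (@measurable_set_coord n l).

(** Exhibits coordinate l as a factor of a product measure, so that Fubini can integrate it alone.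
    On boxes, side l is made full in the first factor and moved to the second. *)
Lemma pow_prob_resample (P : probability T R) n (l : 'I_n) :
  same_law (pow_prob P n \x P) (pow_prob P n) (set_coord l) id.
Proof.
move=> A mA; rewrite preimage_id.
apply: (@box_unique n (distribution (pow_prob P n \x P)%E (set_coord l))
  (pow_prob P n)) => //.
move=> B mB; rewrite pow_prob_box//.
transitivity ((pow_prob P n \x P) (set_coord l @^-1` box B)); first by [].
pose C i := if i == l then setT else B i.
have -> : set_coord l @^-1` box B = box C `*` B l.
  apply/seteqP; split => [[t x] /= h|[t x] /= [h1 h2] i].
    split => [i|]; last by have := h l; rewrite tnth_mktuple eqxx.
    by rewrite /C; have := h i; rewrite tnth_mktuple; case: ifP.
  by rewrite tnth_mktuple; have := h1 i; rewrite /C; case: eqP => // ->.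
have mC i : measurable (C i) by rewrite /C; case: ifP.
transitivity (pow_prob P n (box C) * P (B l)).
  by apply: product_measure1E => //; exact: measurable_box.
rewrite pow_prob_box// (bigD1 l)//= [in RHS](bigD1 l)//= /C eqxx.
rewrite probability_setT mul1e muleC; congr (_ * _).
by apply: eq_bigr => i /negPf ->.
Qed.

End tuple_measure.

(** * Gaussian noise *)

Section normal_second_moment.
Context {R : realType}.
Local Open Scope ereal_scope.
Notation mu := (@lebesgue_measure R).

Lemma ge0_integral_normal_prob (m s : R) (f : measurableTypeR R -> \bar R) :
  measurable_fun setT f -> (forall x, 0 <= f x) ->
  \int[normal_prob m s]_x f x = \int[mu]_x (f x * (normal_pdf m s x)%:E).
Proof.
move=> mf f0; have dom := normal_prob_dominates m s.
rewrite -(Radon_Nikodym_SigmaFinite.change_of_variables dom)//.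
have mpdf : measurable_fun setT (fun x : measurableTypeR R => (normal_pdf m s x)%:E).
  by apply/measurable_EFinP; exact: measurable_normal_pdf.
have ig := Radon_Nikodym_SigmaFinite.f_integrable dom.
have mg := measurable_int _ ig.
apply: ae_eq_integral => //; [exact: emeasurable_funM|exact: emeasurable_funM|].
(* The Radon-Nikodym derivative and the density have the same integral over every measurable set,
   hence agree almost everywhere. *)
apply: ae_eqe_mul2l; apply: integral_ae_eq => // A _ mA.
by rewrite -Radon_Nikodym_SigmaFinite.f_integral.
Qed.

(** Comparison with the density of standard deviation 2, whose integral is known. The exponents
    differ by t = 3 x^2 / 8, and t exp (- t) <= 1 absorbs the factor x^2, whence 8 / 3. *)
Lemma normal_pdf_sqr_le (x : R) :
  (x ^+ 2 * normal_pdf 0 1 x <=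
   8 / 3 * normal_peak (1 : R) / normal_peak 2 * normal_pdf 0 2 x)%R.
Proof.
rewrite !normal_pdfE// /normal_fun !subr0.
set k1 := normal_peak 1; set k2 := normal_peak 2.
have k1_0 : (0 <= k1)%R by exact: normal_peak_ge0.
have k2_0 : (0 < k2)%R by exact: normal_peak_gt0.
pose t : R := (3 / 8 * x ^+ 2)%R.
have -> : (- x ^+ 2 / (1 ^+ 2 *+ 2) = - x ^+ 2 / (2 ^+ 2 *+ 2) - t :> R)%R.
  by rewrite /t; field.
rewrite expRD; set e := expR (- x ^+ 2 / _).
have e0 : (0 <= e)%R by exact: expR_ge0.
have te : (t * expR (- t) <= 1)%R.
  rewrite expRN -ler_pdivlMr ?invr_gt0 ?expR_gt0// invrK mul1r.
  by rewrite (le_trans _ (expR_ge1Dx t))// lerDr.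
have -> : (x ^+ 2 * (k1 * (e * expR (- t))) = 8 / 3 * k1 * e * (t * expR (- t)))%R.
  by rewrite /t; field.
have -> : (8 / 3 * k1 / k2 * (k2 * e) = 8 / 3 * k1 * e :> R)%R.
  by field; rewrite gt_eqF.
by rewrite ler_piMr// !mulr_ge0.
Qed.

Lemma normal_second_moment_lty :
  \int[normal_prob (0 : R) 1]_x ((x : R) ^+ 2)%:E < +oo.
Proof.
have msq : measurable_fun setT (fun x : measurableTypeR R => ((x : R) ^+ 2)%:E).
  by apply/measurable_EFinP; exact: measurable_funX.
rewrite ge0_integral_normal_prob//; last by move=> x; rewrite lee_fin sqr_ge0.
set C := (8 / 3 * normal_peak (1 : R) / normal_peak 2)%R.
have C0 : (0 <= C)%R by rewrite !mulr_ge0// ?invr_ge0 ?normal_peak_ge0.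
have mpdf s : measurable_fun setT (fun x : measurableTypeR R => (normal_pdf 0 s x)%:E).
  by apply/measurable_EFinP; exact: measurable_normal_pdf.
apply: (@le_lt_trans _ _ (\int[mu]_x (C%:E * (normal_pdf 0 2 x)%:E))).
  apply: ge0_le_integral => //.
  - by move=> x _; rewrite mule_ge0 ?lee_fin ?sqr_ge0 ?normal_pdf_ge0.
  - exact: emeasurable_funM.
  - exact: measurable_funeM.
  - by move=> x _; rewrite -!EFinM lee_fin normal_pdf_sqr_le.
rewrite ge0_integralZl//; last by move=> x _; rewrite lee_fin normal_pdf_ge0.
by rewrite integral_normal_pdf mule1 ltry.
Qed.

End normal_second_moment.

Section gaussian_kernel.
Context {R : realType} {d : nat}.
Local Notation Rd := ('rV[R]_d).
Local Open Scope ereal_scope.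

Definition noise : probability (d.-tuple (measurableTypeR R)) R :=
  pow_prob (normal_prob 0 1) d.

Definition noise_row (z : d.-tuple (measurableTypeR R)) : Rd :=
  \row_i (tnth z i : R).

Lemma measurable_noise_row : measurable_fun setT noise_row.
Proof.
apply: measurable_fun_mx => i j; under eq_fun do rewrite mxE.
exact: measurable_tnth.
Qed.

Lemma noise_second_moment :
  exists2 G : R, (0 <= G)%R & \int[noise]_z (enorm (noise_row z) ^+ 2)%:E <= G%:E.
Proof.
pose c := \int[normal_prob (0 : R) 1]_x ((x : R) ^+ 2)%:E.
have c0 : 0 <= c by apply: integral_ge0 => x _; rewrite lee_fin sqr_ge0.
have cfin : c \is a fin_num by rewrite ge0_fin_numE// normal_second_moment_lty.
have msq : measurable_fun setT (fun x : measurableTypeR R => ((x : R) ^+ 2)%:E).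
  by apply/measurable_EFinP; exact: measurable_funX.
exists (fine c *+ d)%R; first by rewrite mulrn_wge0// fine_ge0.
under eq_integral.
  move=> z _; rewrite enorm_sqr /dot -sumEFin.
  under eq_bigr do rewrite !mxE -expr2.
  over.
rewrite ge0_integral_sum//; last 2 first.
- by move=> i; exact: (measurableT_comp msq (@measurable_tnth _ _ _ i)).
- by move=> i z _; rewrite lee_fin sqr_ge0.
rewrite (eq_bigr (fun=> c)); last first.
  move=> i _; have := @same_law_integral _ _ _ _ _ _ _ noise (normal_prob 0 1)
    (fun t => tnth t i) id (fun x => ((x : R) ^+ 2)%:E).
  by apply => //; [exact: measurable_tnth|exact: pow_prob_coord].
by under eq_bigr do rewrite -(fineK cfin); rewrite sumEFin sumr_const card_ord.
Qed.

Context d' {E : measurableType d'} (Q : probability E R) (v : R).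
Local Notation s := (Num.sqrt v).

Lemma measurable_fun_add_noise (m : E -> Rd) : measurable_fun setT m ->
  measurable_fun setT (fun p : E * d.-tuple (measurableTypeR R) =>
    (m p.1 + s *: noise_row p.2)%R).
Proof.
move=> mm; apply: measurable_fun_rowD.
  exact: measurableT_comp.
apply: measurable_fun_rowZ.
exact: (measurableT_comp measurable_noise_row).
Qed.

(** As the measure of a section, the kernel is measurable in e, and integrating it over e gives a
    product measure by definition. *)
Lemma gauss_section (m : E -> Rd) e A :
  gauss (m e) v A = noise (xsection
    ((fun p : E * d.-tuple (measurableTypeR R) =>
      (m p.1 + s *: noise_row p.2)%R) @^-1` A) e).
Proof.
rewrite /xsection; transitivity (noise (affine_row (m e) s @^-1` A)) => //.
by congr (noise _); apply/seteqP; split => z /=; rewrite inE.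
Qed.

Lemma measurable_gauss (m : E -> Rd) A : measurable A ->
  measurable_fun setT m -> measurable_fun setT (fun e => gauss (m e) v A).
Proof.
move=> mA mm; under eq_fun do rewrite (gauss_section m).
apply: (@measurable_fun_xsection _ _ E _ R noise).
by rewrite -[X in measurable X]setTI; exact: measurable_fun_add_noise.
Qed.

Lemma add_noise_law (m : E -> Rd) A : measurable A -> measurable_fun setT m ->
  (Q \x noise) ((fun p => m p.1 + s *: noise_row p.2)%R @^-1` A) =
  \int[Q]_e gauss (m e) v A.
Proof.
move=> mA mm; rewrite /product_measure1; apply: eq_integral => e _ /=.
by rewrite (gauss_section m).
Qed.

(** Given e, independent noises produce independent Gaussian positions; the right-hand side is the
    form in which [particle_dynamics] prescribes the next configuration. *)
Lemma add_noises_law N (m : 'I_N -> E -> Rd) (B : 'I_N -> set Rd) :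
  (forall i, measurable (B i)) -> (forall i, measurable_fun setT (m i)) ->
  (Q \x pow_prob noise N)
    [set p | forall i, B i (m i p.1 + s *: noise_row (tnth p.2 i))%R] =
  \int[Q]_e \prod_(i < N) gauss (m i e) v (B i).
Proof.
move=> mB mm; rewrite /product_measure1; apply: eq_integral => e _ /=.
transitivity (pow_prob noise N (box (fun i => affine_row (m i e) s @^-1` B i))).
  by congr (pow_prob _ _ _); apply/seteqP; split => z /=; rewrite /xsection/= inE.
rewrite pow_prob_box// => i; rewrite -[X in measurable X]setTI.
exact: measurable_funPT.
Qed.

End gaussian_kernel.

(** * Bounds for integrals, first and second moments *)

Section integrals.
Context d' {E : measurableType d'} {R : realType}.

Lemma integrable_le (Q : {measure set E -> \bar R}) (f g : E -> R) :
  measurable_fun setT f -> measurable_fun setT g ->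
  (forall e, `|f e| <= g e) -> (\int[Q]_e (g e)%:E < +oo)%E ->
  Q.-integrable setT (EFin \o f).
Proof.
move=> mf mg fg gQ.
have g0 e : 0 <= g e by exact: le_trans (fg e).
apply: (@le_integrable _ _ _ _ _ measurableT _ (EFin \o g)).
- exact/measurable_EFinP.
- by move=> e _ /=; rewrite lee_fin (le_trans (fg e))// ler_norm.
- apply/integrableP; split; first exact/measurable_EFinP.
  by under eq_integral do rewrite gee0_abs ?lee_fin//.
Qed.

Lemma integral_prob_cst (Q : probability E R) (c : \bar R) : (\int[Q]__ c = c)%E.
Proof.
rewrite integral_cst// -[RHS]mule1; congr (_ * _)%E; exact: probability_setT.
Qed.

Lemma integral_affine_le (Q : probability E R) (f : E -> R) (a b k : R) :
  measurable_fun setT f -> (forall e, 0 <= f e) -> 0 <= a -> 0 <= b ->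
  (\int[Q]_e (f e)%:E <= k%:E)%E ->
  (\int[Q]_e (a + b * f e)%:E <= (a + b * k)%:E)%E.
Proof.
move=> mf f0 a0 b0 fk.
under eq_integral do rewrite EFinD EFinM.
rewrite ge0_integralD//; last 2 first.
- by move=> e _; rewrite mule_ge0 ?lee_fin.
- by apply: measurable_funeM; exact/measurable_EFinP.
rewrite integral_prob_cst EFinD EFinM leeD2l//.
rewrite ge0_integralZl//; [|exact/measurable_EFinP|by move=> e _; rewrite lee_fin].
by rewrite lee_wpmul2l// lee_fin.
Qed.

(** Integrates f <= a / 2 + f^2 / (2 a) with a = sqrt m, which amounts to (f - a)^2 >= 0. The
    division by a is why moment bounds are kept positive throughout. *)
Lemma integral_le_sqrt (Q : probability E R) (f : E -> R) (m : R) :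
  measurable_fun setT f -> (forall e, 0 <= f e) -> 0 < m ->
  (\int[Q]_e (f e ^+ 2)%:E <= m%:E)%E -> (\int[Q]_e (f e)%:E <= (Num.sqrt m)%:E)%E.
Proof.
move=> mf f0 m0 fm; set a := Num.sqrt m.
have a0 : 0 < a by rewrite sqrtr_gt0.
have mE : m = a ^+ 2 by rewrite sqr_sqrtr ?ltW.
have -> : a%:E = (a / 2 + (2 * a)^-1 * m)%:E.
  by congr EFin; rewrite mE; field; rewrite gt_eqF.
apply: (@le_trans _ _ (\int[Q]_e (a / 2 + (2 * a)^-1 * f e ^+ 2)%:E)%E).
  apply: ge0_le_integral => //.
  - by move=> e _; rewrite lee_fin.
  - exact/measurable_EFinP.
  - apply/measurable_EFinP; apply: measurable_funD => //.
    by apply: measurable_funM => //; exact: measurable_funX.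
  - move=> e _; rewrite lee_fin -(ler_pM2l (_ : 0 < 2 * a)) ?mulr_gt0//.
    rewrite mulrDr mulVKf ?gt_eqF ?mulr_gt0//.
    have := sqr_ge0 (f e - a); nra.
apply: integral_affine_le => //; first exact: measurable_funX.
- by move=> e; rewrite sqr_ge0.
- by rewrite divr_ge0// ltW.
- by rewrite invr_ge0 mulr_ge0// ltW.
Qed.

Lemma lty_bound (x : \bar R) : (0 <= x)%E -> (x < +oo)%E ->
  exists2 k : R, 0 <= k & x = k%:E.
Proof.
by move=> x0 xy; exists (fine x); [exact: fine_ge0|rewrite fineK// ge0_fin_numE].
Qed.

Context {d : nat}.

(* Pairing the vector integral with itself and applying Cauchy-Schwarz
   pointwise. *)
Lemma enorm_integral (Q : {measure set E -> \bar R}) (f : E -> 'rV[R]_d) (k : R) :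
  measurable_fun setT f -> (\int[Q]_e (enorm (f e))%:E <= k%:E)%E ->
  enorm (\row_i \int[Q]_e f e 0 i) <= k.
Proof.
move=> mf fk; set I := \row_i _.
have k0 : 0 <= k.
  rewrite -lee_fin (le_trans _ fk)// integral_ge0// => e _.
  by rewrite lee_fin enorm_ge0.
have mnf : measurable_fun setT (fun e => enorm (f e)) by exact: measurable_fun_enorm.
have foo : (\int[Q]_e (enorm (f e))%:E < +oo)%E by rewrite (le_lt_trans fk)// ltry.
have fi i : Q.-integrable setT (fun e => (f e 0 i)%:E).
  apply: (@integrable_le _ (fun e => f e 0 i) (fun e => enorm (f e))) => //.
    exact: measurable_fun_coord.
  by move=> e; exact: normr_le_enorm.
have Ifi i : Q.-integrable setT (fun e => (I 0 i * f e 0 i)%:E).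
  by under eq_fun do rewrite EFinM; exact: integrableZl.
have [I0|I0] := eqVneq (enorm I) 0; first by rewrite I0.
have {}I0 : 0 < enorm I by rewrite lt_def I0 enorm_ge0.
rewrite -(ler_pM2l I0) -expr2 enorm_sqr -lee_fin.
have -> : (dot I I)%:E = (\int[Q]_e (dot I (f e))%:E)%E.
  rewrite /dot -sumEFin; under [in RHS]eq_integral do rewrite -sumEFin.
  rewrite integral_sum//.
  apply: eq_bigr => i _; under eq_integral do rewrite EFinM.
  rewrite integralZl// [in RHS]/I EFinM; congr (_ * _)%E.
  by rewrite /I mxE /Rintegral fineK//; exact: integrable_fin_num.
rewrite EFinM (@le_trans _ _ (\int[Q]_e ((enorm I)%:E * (enorm (f e))%:E))%E)//.
  apply: le_integral => //.
  - rewrite /dot; under eq_fun do rewrite -sumEFin.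
    exact: integrable_sum.
  - apply: integrableZl => //; apply/integrableP; split; first exact/measurable_EFinP.
    by under eq_integral do rewrite gee0_abs ?lee_fin ?enorm_ge0//.
  - by move=> e _; rewrite -EFinM lee_fin dot_le_enorm.
rewrite ge0_integralZl//.
- by rewrite lee_wpmul2l// lee_fin ltW.
- exact/measurable_EFinP.
- by move=> e _; rewrite lee_fin enorm_ge0.
- by rewrite lee_fin ltW.
Qed.

End integrals.

(** * The drift of the Euler-Maruyama step *)

Section drift.
Context {R : realType} {d : nat}.
Local Notation Rd := ('rV[R]_d).
Context {delta : R} {V W : Rd -> R} {lV lW CV CW : R}.
Context (delta0 : 0 < delta) (dV : twice_differentiable V)
  (dW : twice_differentiable W) (hV : forall x, mx_ge (hess V x) lV)
  (hW : forall x, mx_ge (hess W x) lW) (LV : elipschitz CV (grad V))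
  (LW : elipschitz CW (grad W)) (CV0 : 0 <= CV) (CW0 : 0 <= CW).

Let r := 1 - 2 * delta * (lV + lW) + delta ^+ 2 * (CV + CW) ^+ 2.

Lemma shift_sub (x y z : Rd) : x - z - (y - z) = x - y.
Proof. by rewrite opprB addrA subrK. Qed.

Lemma grad_shift_lipschitz_l z x y : edist (grad W (x - z)) (grad W (y - z)) <= CW * edist x y.
Proof.
have := LW (x - z) (y - z).
by rewrite {2}/edist shift_sub.
Qed.

Lemma grad_shift_lipschitz_r z z' x :
  edist (grad W (x - z)) (grad W (x - z')) <= CW * edist z z'.
Proof.
have := LW (x - z) (x - z').
have E : x - z - (x - z') = z' - z by rewrite opprB addrC addrA subrK.
by rewrite {2}/edist E -/(edist z' z) [edist z' z]edistC.
Qed.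

(** Both points interact with the same z, so the shift cancels and the convexity bound on W adds to
    that on V. With u = x - y and g the total gradient increment, |u|^2 - 2 delta u.g + delta^2
    |g|^2 is bounded using u.g >= (lV + lW) |u|^2 and |g| <= (CV + CW) |u|. *)
Lemma gradient_step_le x y z :
  enorm (x - y - delta *: (grad V x - grad V y)
         - delta *: (grad W (x - z) - grad W (y - z)))
  <= Num.sqrt r * edist x y.
Proof.
set u := x - y; pose g := (grad V x - grad V y) + (grad W (x - z) - grad W (y - z)).
rewrite -addrA -opprD -scalerDr -/g.
have ug : (lV + lW) * enorm u ^+ 2 <= dot u g.
  rewrite mulrDl dotDr lerD//; first exact: hess_ge_monotone.
  have := hess_ge_monotone dW hW (x - z) (y - z).
  by rewrite /edist shift_sub.
have gn : enorm g <= (CV + CW) * enorm u.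
  by rewrite (le_trans (enormD _ _))// mulrDl lerD//; [exact: LV|exact: grad_shift_lipschitz_l].
rewrite /edist -/u; clearbody u g.
have u0 := enorm_ge0 u; have g0 := enorm_ge0 g.
have gn2 : enorm g ^+ 2 <= (CV + CW) ^+ 2 * enorm u ^+ 2.
  by rewrite -exprMn lerXn2r ?nnegrE// mulr_ge0// addr_ge0.
rewrite -(ger0_norm (enorm_ge0 (u - _))) -sqrtr_sqr.
(* [sqrtrM] asks only for the sign of the first factor, so that of [r] is left open. *)
have -> : Num.sqrt r * enorm u = Num.sqrt (enorm u ^+ 2 * r).
  by rewrite sqrtrM ?sqr_ge0// sqrtr_sqr ger0_norm// mulrC.
rewrite ler_wsqrtr// (enorm_sqr (u - _)) -scaleNr.
rewrite !(dotDl, dotDr, dotZl, dotZr) -!enorm_sqr (dotC g u).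
have := ler_wpM2l (ltW delta0) ug.
have := ler_wpM2l (sqr_ge0 delta) gn2.
rewrite /r; move: (dot u g) (enorm u ^+ 2) (enorm g ^+ 2) => *; nra.
Qed.

(* The convolution of grad W with the law of z under Q. *)
Definition conv_law d' (E : measurableType d') (Q : {measure set E -> \bar R})
  (z : E -> Rd) (x : Rd) : Rd := \row_i \int[Q]_e grad W (x - z e) 0 i.

Lemma grad_conv_law d' (E : measurableType d') (Q : probability E R)
    (mu : probability Rd R) (z : E -> Rd) x :
  measurable_fun setT z -> same_law Q mu z id ->
  grad_conv W mu x = conv_law Q z x.
Proof.
move=> mz zmu; apply/rowP => i; rewrite !mxE /Rintegral; congr fine.
apply/esym.
apply: (same_law_integral (f := fun t : Rd => (grad W (x - t) 0 i)%:E)) => //.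
apply/measurable_EFinP.
apply: measurable_fun_coord; apply: measurableT_comp (elipschitz_measurable LW) _.
exact: measurable_fun_rowB.
Qed.

Section law.
Context d' {E : measurableType d'} (Q : probability E R).

Lemma integrable_gradW_shift (z : E -> Rd) (x : Rd) i : measurable_fun setT z -> (\int[Q]_e (enorm (z e))%:E < +oo)%E ->
  Q.-integrable setT (fun e => (grad W (x - z e) 0 i)%:E).
Proof.
move=> mz /(lty_bound (integral_ge0 _ _))[|k k0 kE].
  by move=> e _; rewrite lee_fin enorm_ge0.
have mn := measurable_fun_enorm mz.
(* Linear growth: |grad W (x - z)| <= |grad W x| + CW |z|. *)
pose a := enorm (grad W x).
apply: (@integrable_le _ _ _ _ _ (fun e => a + CW * enorm (z e))).
- apply: measurable_fun_coord; apply: measurableT_comp (elipschitz_measurable LW) _.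
  exact: measurable_fun_rowB.
- by apply: measurable_funD => //; exact: measurable_funM.
- move=> e; rewrite (le_trans (normr_le_enorm _ i))//.
  rewrite -lerBlDl (le_trans (ler_norm _))// (le_trans (enorm_dist _ _))//.
  rewrite /edist -{2}[x]subr0 (le_trans (grad_shift_lipschitz_r _ _ _))//.
  by rewrite /edist subr0.
- rewrite (le_lt_trans _ (ltry (a + CW * k)))//.
  by apply: integral_affine_le; rewrite ?enorm_ge0 ?kE// => e; exact: enorm_ge0.
Qed.

Lemma conv_law_lipschitz (z : E -> Rd) : measurable_fun setT z ->
  (\int[Q]_e (enorm (z e))%:E < +oo)%E -> elipschitz CW (conv_law Q z).
Proof.
move=> mz iz x y; rewrite /edist.
have mg x0 : measurable_fun setT (fun e => grad W (x0 - z e)).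
  apply: measurableT_comp (elipschitz_measurable LW) _.
  exact: measurable_fun_rowB.
rewrite [X in enorm X](_ : _ =
    \row_i \int[Q]_e (grad W (x - z e) - grad W (y - z e)) 0 i).
  apply: enorm_integral; first by apply: measurable_fun_rowB.
  rewrite -[leRHS](integral_prob_cst Q); apply: ge0_le_integral => //.
  - by move=> e _; rewrite lee_fin enorm_ge0.
  - by apply/measurable_EFinP; apply: measurable_fun_enorm; exact: measurable_fun_rowB.
  - by move=> e _; rewrite lee_fin grad_shift_lipschitz_l.
apply/rowP => i; rewrite !mxE -RintegralB//; [|exact: integrable_gradW_shift|exact: integrable_gradW_shift].
by apply: eq_Rintegral => e _; rewrite !mxE.
Qed.

(** Everything is put under the integral, and grad W (y - z e) is inserted pointwise: passing from x
    to y with z frozen is [gradient_step_le], passing from z to z' uses only the Lipschitz bound.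
    The triangle inequality comes after the contraction, so the second coefficient is delta CW. *)
Lemma drift_dist_law (z z' : E -> Rd) (x y : Rd) (k : R) :
  measurable_fun setT z -> measurable_fun setT z' ->
  (\int[Q]_e (enorm (z e))%:E < +oo)%E -> (\int[Q]_e (enorm (z' e))%:E < +oo)%E ->
  (\int[Q]_e (edist (z e) (z' e))%:E <= k%:E)%E ->
  enorm ((x - delta *: grad V x - delta *: conv_law Q z x) -
         (y - delta *: grad V y - delta *: conv_law Q z' y))
  <= Num.sqrt r * edist x y + delta * CW * k.
Proof.
move=> mz mz' iz iz' zk.
have mg (x0 : Rd) (z0 : E -> Rd) : measurable_fun setT z0 -> measurable_fun setT (fun e => grad W (x0 - z0 e)).
  move=> mz0; apply: measurableT_comp (elipschitz_measurable LW) _.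
  exact: measurable_fun_rowB.
pose f e := (x - y - delta *: (grad V x - grad V y)) -
  delta *: (grad W (x - z e) - grad W (y - z' e)).
have mf : measurable_fun setT f.
  apply: measurable_fun_rowB => //; apply: measurable_fun_rowZ.
  by apply: measurable_fun_rowB; exact: mg.
rewrite [X in enorm X](_ : _ = \row_i \int[Q]_e f e 0 i).
  apply: enorm_integral => //.
  apply: (@le_trans _ _ (\int[Q]_e (Num.sqrt r * edist x y
                           + delta * CW * edist (z e) (z' e))%:E)%E).
    have md : measurable_fun setT (fun e => edist (z e) (z' e)).
      by apply: measurable_fun_enorm; exact: measurable_fun_rowB.
    apply: ge0_le_integral => //.
    - by move=> e _; rewrite lee_fin enorm_ge0.
    - by apply/measurable_EFinP; exact: measurable_fun_enorm.
    - apply/measurable_EFinP; apply: measurable_funD => //.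
      exact: measurable_funM.
    - move=> e _; rewrite lee_fin.
      rewrite [f e](_ : _ = (x - y - delta *: (grad V x - grad V y)
         - delta *: (grad W (x - z e) - grad W (y - z e)))
         - delta *: (grad W (y - z e) - grad W (y - z' e))); last first.
        rewrite /f -[RHS]addrA -opprD -scalerDr; congr (_ - _ *: _).
        by rewrite addrA subrK.
      rewrite (le_trans (enormB _ _))// lerD ?gradient_step_le//.
      by rewrite enormZ gtr0_norm// -mulrA ler_wpM2l ?(ltW delta0)// grad_shift_lipschitz_r.
  apply: integral_affine_le => //.
  - by apply: measurable_fun_enorm; exact: measurable_fun_rowB.
  - by move=> e; exact: edist_ge0.
  - by rewrite mulr_ge0// ?sqrtr_ge0 ?edist_ge0.
  - by rewrite mulr_ge0// ltW.
apply/rowP => i.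
have ix := integrable_gradW_shift x i mz iz; have iy := integrable_gradW_shift y i mz' iz'.
have ixy : Q.-integrable setT (fun e => (grad W (x - z e) 0 i - grad W (y - z' e) 0 i)%:E).
  by under eq_fun do rewrite EFinB; exact: integrableB.
pose a := (x - y - delta *: (grad V x - grad V y)) 0 i.
transitivity (\int[Q]_e (a - delta * (grad W (x - z e) 0 i - grad W (y - z' e) 0 i))).
  rewrite RintegralB//.
  - rewrite /= RintegralZl// RintegralB//.
    have -> : \int[Q]_x a = a by rewrite /Rintegral integral_prob_cst.
    have cE z0 x0 : \int[Q]_e grad W (x0 - z0 e) 0 i = conv_law Q z0 x0 0 i.
      by rewrite mxE.
    rewrite !cE /a; move: (conv_law Q z x) (conv_law Q z' y) (grad V x) (grad V y).
    by move=> p p' q q'; rewrite !mxE; ring.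
  - exact: finite_measure_integrable_cst.
  - rewrite /comp; under eq_fun do rewrite EFinM; exact: integrableZl.
rewrite mxE; apply: eq_Rintegral => e _; rewrite /a /f.
move: (grad W _) (grad W _) (grad V x) (grad V y) => p p' q q'.
by rewrite !mxE.
Qed.

End law.

Definition em_drift (mu : {measure set Rd -> \bar R}) (x : Rd) : Rd :=
  x - delta *: grad V x - delta *: grad_conv W mu x.

Lemma em_drift_law d' (E : measurableType d') (Q : probability E R)
    (mu : probability Rd R) (z : E -> Rd) x :
  measurable_fun setT z -> same_law Q mu z id ->
  em_drift mu x = x - delta *: grad V x - delta *: conv_law Q z x.
Proof. by move=> mz zmu; rewrite /em_drift (grad_conv_law _ mz zmu). Qed.

Lemma measurable_em_drift (mu : probability Rd R) :
  finite_first_moment mu -> measurable_fun setT (em_drift mu).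
Proof.
move=> mu1; rewrite /em_drift; apply: measurable_fun_rowB.
  apply: measurable_fun_rowB => //; apply: measurable_fun_rowZ.
  exact: elipschitz_measurable LV.
apply: measurable_fun_rowZ.
exact: (elipschitz_measurable (conv_law_lipschitz (@measurable_id _ _ setT) mu1)).
Qed.

Section empirical.
Context {N : nat} (N0 : (0 < N)%N).
Implicit Types x y : N.-tuple Rd.

Lemma Rintegral_empirical x (g : Rd -> R) : measurable_fun setT g ->
  \int[empirical x]_t g t = N%:R^-1 * \sum_(j < N) g (tnth x j).
Proof.
move=> mg; rewrite /Rintegral.
have h (f : Rd -> \bar R) : measurable_fun setT f -> (forall t, 0 <= f t)%E ->
    (\int[empirical x]_t f t = N%:R^-1%:E * \sum_(j < N) f (tnth x j))%E.
  move=> mf f0; rewrite ge0_integral_mscale// ge0_integral_measure_sum//.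
  congr (_ * _)%E; apply: eq_bigr => j _.
  by rewrite integral_dirac// diracT mul1e -tnth_nth.
pose f t := (g t)%:E.
have mf : measurable_fun setT f by exact/measurable_EFinP.
rewrite integralE !h//; [|exact: measurable_funeneg|exact: measurable_funepos].
have E (s : R -> R) : (\sum_(j < N) (s (g (tnth x j)))%:E =
    (\sum_(j < N) s (g (tnth x j)))%:E)%E by rewrite sumEFin.
pose p a : R := Num.max a 0; pose q a : R := Num.max (- a) 0.
rewrite (eq_bigr (fun j => (p (g (tnth x j)))%:E)); last first.
  by move=> j _; rewrite funeposE /p EFin_max.
rewrite [X in (_ - _ * X)%E](eq_bigr (fun j => (q (g (tnth x j)))%:E)); last first.
  by move=> j _; rewrite funenegE /q EFin_max.
rewrite !E -!EFinM -EFinB /= -mulrBr -sumrB; congr (_ * _).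
apply: eq_bigr => j _; rewrite /p /q; by case: leP => ?; case: leP => ?; lra.
Qed.

Lemma grad_conv_empirical x (y : Rd) :
  grad_conv W (empirical x) y = N%:R^-1 *: \sum_(j < N) grad W (y - tnth x j).
Proof.
apply/rowP => i; rewrite !mxE Rintegral_empirical.
  by rewrite summxE.
apply: measurable_fun_coord; apply: measurableT_comp (elipschitz_measurable LW) _.
exact: measurable_fun_rowB.
Qed.

Lemma measurable_em_drift_empirical (i : 'I_N) :
  measurable_fun setT (fun x : N.-tuple Rd => em_drift (empirical x) (tnth x i)).
Proof.
rewrite /em_drift; under eq_fun do rewrite grad_conv_empirical.
have mt j := @measurable_tnth _ Rd N j.
apply: measurable_fun_rowB.
  apply: measurable_fun_rowB => //; apply: measurable_fun_rowZ.
  exact: (measurableT_comp (elipschitz_measurable LV) (mt i)).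
apply: measurable_fun_rowZ; apply: measurable_fun_rowZ.
apply: measurable_fun_row_sum => j.
apply: measurableT_comp (elipschitz_measurable LW) _.
exact: measurable_fun_rowB.
Qed.

(** The insertion of [drift_dist_law] again, with a finite average in place of the integral: the two
    empirical measures are coupled by pairing their j-th points. *)
Lemma em_drift_empirical_dist x y (i : 'I_N) :
  edist (em_drift (empirical x) (tnth x i)) (em_drift (empirical y) (tnth y i))
  <= Num.sqrt r * edist (tnth x i) (tnth y i)
     + delta * CW * (N%:R^-1 * \sum_(j < N) edist (tnth x j) (tnth y j)).
Proof.
set xi := tnth x i; set yi := tnth y i.
have Nn0 : (N%:R : R) != 0 by rewrite pnatr_eq0 -lt0n.
have cst (a : Rd) : N%:R^-1 *: \sum_(j < N) a = a.
  by rewrite sumr_const card_ord -[a *+ N]scaler_nat scalerA mulVf// scale1r.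
pose c := xi - yi - delta *: (grad V xi - grad V yi).
pose p j := grad W (xi - tnth x j); pose q j := grad W (yi - tnth y j).
pose f j := (c - delta *: (p j - grad W (yi - tnth x j)))
         - delta *: (grad W (yi - tnth x j) - q j).
have fE j : f j = c - delta *: (p j - q j).
  rewrite /f {f}; move: c (p j) (q j) (grad W (yi - _)) => c0 u v w.
  by rewrite -addrA -opprD -scalerDr addrA subrK.
rewrite /edist [X in enorm X](_ : _ = N%:R^-1 *: \sum_j f j).
  rewrite enormZ ger0_norm ?invr_ge0// mulrCA.
  have -> : Num.sqrt r * enorm (xi - yi) =
      N%:R^-1 * \sum_(j < N) (Num.sqrt r * enorm (xi - yi)).
    by rewrite sumr_const card_ord -[_ * _ *+ N]mulr_natl mulKf.
  rewrite -mulrDr ler_wpM2l ?invr_ge0// (le_trans (enorm_sum _ _))//.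
  rewrite mulr_sumr -big_split/=; apply: ler_sum => j _.
  rewrite (le_trans (enormB _ _))// lerD ?gradient_step_le//.
  by rewrite enormZ gtr0_norm// -mulrA ler_wpM2l ?(ltW delta0)// grad_shift_lipschitz_r.
under eq_bigr do rewrite fE.
rewrite sumrB scalerBr cst -scaler_sumr sumrB /em_drift !grad_conv_empirical.
rewrite -/xi -/yi /c; move: (\sum_j p j) (\sum_j q j) => P Q.
move: (grad V xi) (grad V yi) => g g'.
by apply/rowP => k; rewrite !mxE; ring.
Qed.

End empirical.

End drift.

(** * Wasserstein contraction of one mean-field step *)

Section wasserstein_bounds.
Local Open Scope ereal_scope.
Context d {T : measurableType d} {R : realType}.

(** The joint law of X and Y is an admissible coupling, so upper bounds on [W1] reduce to
    constructing two variables on any common space. *)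
Lemma W1_le d' (E : measurableType d') (Q : probability E R) (X Y : E -> T)
    (dist : T -> T -> R) (mu nu : set T -> \bar R) :
  measurable_fun setT X -> measurable_fun setT Y ->
  measurable_fun setT (fun z : T * T => dist z.1 z.2) ->
  (forall x y, 0 <= dist x y)%R ->
  (forall A, measurable A -> Q (X @^-1` A) = mu A) ->
  (forall A, measurable A -> Q (Y @^-1` A) = nu A) ->
  W1 dist mu nu <= \int[Q]_e (dist (X e) (Y e))%:E.
Proof.
move=> mX mY md d0 Xmu Ynu.
pose F e := (X e, Y e).
have mF : measurable_fun setT F by exact: measurable_fun_pair.
pose F' : {mfun E >-> (T * T)%type} :=
  HB.pack F (isMeasurableFun.Build _ _ _ _ F mF).
apply: ereal_inf_lbound; exists (distribution Q F').
  move=> A mA; split.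
    rewrite -Xmu//; congr (Q _); apply/seteqP; split => [e []//|e ?]; exact.
  rewrite -Ynu//; congr (Q _); apply/seteqP; split => [e []//|e ?]; exact.
rewrite ge0_integral_distribution//; last by move=> z; rewrite lee_fin.
exact/measurable_EFinP.
Qed.

Lemma coupling_same_law (mu nu : probability T R)
    (pi : probability (T * T)%type R) :
  coupling mu nu pi -> same_law pi mu fst id /\ same_law pi nu snd id.
Proof.
move=> pimu; split => A mA; rewrite preimage_id.
  rewrite -(pimu A mA).1; congr (pi _).
  by apply/seteqP; split => [[? ?]|[? ?] []].
rewrite -(pimu A mA).2; congr (pi _).
by apply/seteqP; split => [[? ?]|[? ?] []].
Qed.

Lemma integral_prod_fst d1 d2 (E1 : measurableType d1) (E2 : measurableType d2)
    (Q1 : probability E1 R) (Q2 : probability E2 R) (f : E1 -> \bar R) :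
  measurable_fun setT f -> (forall e, 0 <= f e) ->
  \int[Q1 \x Q2]_p f p.1 = \int[Q1]_e f e.
Proof.
move=> mf f0; rewrite fubini_tonelli1//; last exact: measurableT_comp.
by apply: eq_integral => e _; rewrite /fubini_F /= integral_prob_cst.
Qed.

Lemma integral_prod_snd d1 d2 (E1 : measurableType d1) (E2 : measurableType d2)
    (Q1 : probability E1 R) (Q2 : probability E2 R) (f : E2 -> \bar R) :
  measurable_fun setT f -> (forall e, 0 <= f e) ->
  \int[Q1 \x Q2]_p f p.2 = \int[Q2]_e f e.
Proof.
move=> mf f0; rewrite fubini_tonelli1//; last exact: measurableT_comp.
by rewrite /fubini_F /= integral_prob_cst.
Qed.

End wasserstein_bounds.

Section mean_field_step.
Context {R : realType} {d : nat}.
Local Notation Rd := ('rV[R]_d).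
Context {delta : R} {V W : Rd -> R} {lV lW CV CW : R}.
Context (delta0 : 0 < delta) (dV : twice_differentiable V)
  (dW : twice_differentiable W) (hV : forall x, mx_ge (hess V x) lV)
  (hW : forall x, mx_ge (hess W x) lW) (LV : elipschitz CV (grad V))
  (LW : elipschitz CW (grad W)) (CV0 : 0 <= CV) (CW0 : 0 <= CW).

Let r := 1 - 2 * delta * (lV + lW) + delta ^+ 2 * (CV + CW) ^+ 2.
Local Notation K := (em_kernel delta V W).
Local Notation drift := (@em_drift R d delta V W).
Local Notation s := (Num.sqrt (2 * delta)).
Local Notation noise := (@noise R d).

Lemma edist_addr (u v w : Rd) : edist (u + w) (v + w) = edist u v.
Proof. by rewrite /edist opprD addrACA subrr addr0. Qed.

Lemma mean_field_step_law d' (E : measurableType d') (Q : probability E R)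
    (z : E -> Rd) (mu : probability Rd R) A :
  measurable A -> measurable_fun setT z -> same_law Q mu z id ->
  finite_first_moment mu ->
  (Q \x noise)%E
    ((fun p => drift mu (z p.1) + s *: noise_row p.2) @^-1` A) =
  apply_kernel mu (K mu) A.
Proof.
move=> mA mz zmu mu1; have md : measurable_fun setT (drift mu) := measurable_em_drift LV LW CW0 mu1.
rewrite [LHS](add_noise_law Q (2 * delta) mA (measurableT_comp md mz)).
apply: (same_law_integral (f := fun x => gauss (drift mu x) (2 * delta) A)) => //.
exact: measurable_gauss.
Qed.

(** The coupling [pi] itself serves as the probability space, its projections being the two
    interaction variables. *)
Lemma em_drift_dist (mu nu : probability Rd R) (pi : probability (Rd * Rd)%type R)
    (k : R) :
  coupling mu nu pi -> finite_first_moment mu -> finite_first_moment nu ->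
  (\int[pi]_z (edist z.1 z.2)%:E <= k%:E)%E ->
  forall x y, edist (drift mu x) (drift nu y)
    <= Num.sqrt r * edist x y + delta * CW * k.
Proof.
move=> pimu mu1 nu1 zk x y.
have [law1 law2] := coupling_same_law pimu.
rewrite (em_drift_law LW x _ law1)// (em_drift_law LW y _ law2)//.
have men : measurable_fun setT (fun t : Rd => (enorm t)%:E).
  by apply/measurable_EFinP; exact: measurable_enorm.
apply: (drift_dist_law delta0 dV dW hV hW LV LW) => //.
- by rewrite (same_law_integral (f := fun t : Rd => (enorm t)%:E) _ _ law1).
- by rewrite (same_law_integral (f := fun t : Rd => (enorm t)%:E) _ _ law2).
Qed.

Lemma measurable_edist_pair : measurable_fun setT (fun z : Rd * Rd => edist z.1 z.2).
Proof. by apply: measurable_fun_enorm; exact: measurable_fun_rowB. Qed.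

(* The two copies are driven by the same Gaussian noise, which cancels in the
   difference. *)
Lemma W1_step_le (mu nu : probability Rd R) (pi : probability (Rd * Rd)%type R)
    (k : R) :
  coupling mu nu pi -> finite_first_moment mu -> finite_first_moment nu ->
  (\int[pi]_z (edist z.1 z.2)%:E <= k%:E)%E ->
  (W1 edist (apply_kernel mu (K mu)) (apply_kernel nu (K nu))
   <= ((Num.sqrt r + delta * CW) * k)%:E)%E.
Proof.
move=> pimu mu1 nu1 zk.
have k0 : 0 <= k.
  rewrite -lee_fin (le_trans _ zk)// integral_ge0// => e _.
  by rewrite lee_fin edist_ge0.
have [law1 law2] := coupling_same_law pimu.
have mdm : measurable_fun setT (drift mu) := measurable_em_drift LV LW CW0 mu1.
have mdn : measurable_fun setT (drift nu) := measurable_em_drift LV LW CW0 nu1.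
pose X (p : (Rd * Rd) * d.-tuple (measurableTypeR R)) :=
  drift mu p.1.1 + s *: noise_row p.2.
pose Y (p : (Rd * Rd) * d.-tuple (measurableTypeR R)) :=
  drift nu p.1.2 + s *: noise_row p.2.
have mX : measurable_fun setT X.
  exact: (measurable_fun_add_noise (2 * delta) (measurableT_comp mdm measurable_fst)).
have mY : measurable_fun setT Y.
  exact: (measurable_fun_add_noise (2 * delta) (measurableT_comp mdn measurable_snd)).
apply: le_trans (W1_le (Q := (pi \x noise)%E) mX mY measurable_edist_pair _ _ _) _.
- exact: edist_ge0.
- by move=> A mA; apply: (mean_field_step_law mA _ law1 mu1).
- by move=> A mA; apply: (mean_field_step_law mA _ law2 nu1).
pose f (z : Rd * Rd) := edist (drift mu z.1) (drift nu z.2).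
have mf : measurable_fun setT f.
  by apply: measurable_fun_enorm; apply: measurable_fun_rowB; exact: measurableT_comp.
rewrite (eq_integral (fun p => (f p.1)%:E)); last first.
  by move=> p _; rewrite edist_addr.
rewrite (integral_prod_fst pi noise (f := fun z => (f z)%:E)); last 2 first.
- exact/measurable_EFinP.
- by move=> z; rewrite lee_fin edist_ge0.
apply: (@le_trans _ _ (\int[pi]_z (delta * CW * k + Num.sqrt r * edist z.1 z.2)%:E)%E).
  apply: ge0_le_integral => //.
  - by move=> z _; rewrite lee_fin edist_ge0.
  - exact/measurable_EFinP.
  - apply/measurable_EFinP; apply: measurable_funD => //.
    by apply: measurable_funM => //; exact: measurable_edist_pair.
  - move=> z _; rewrite lee_fin addrC; exact: (em_drift_dist pimu).
rewrite mulrDl addrC; apply: integral_affine_le => //.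
- exact: measurable_edist_pair.
- by move=> z; exact: edist_ge0.
- by rewrite !mulr_ge0// ltW.
Qed.

Lemma coupling_cost_lty (mu nu : probability Rd R) (pi : probability (Rd * Rd)%type R) :
  coupling mu nu pi -> finite_first_moment mu -> finite_first_moment nu ->
  (\int[pi]_z (edist z.1 z.2)%:E < +oo)%E.
Proof.
move=> pimu mu1 nu1.
have [law1 law2] := coupling_same_law pimu.
have men : measurable_fun setT (fun t : Rd => (enorm t)%:E).
  by apply/measurable_EFinP; exact: measurable_enorm.
have men1 : measurable_fun setT (fun z : Rd * Rd => (enorm z.1)%:E).
  exact: (measurableT_comp men measurable_fst).
have men2 : measurable_fun setT (fun z : Rd * Rd => (enorm z.2)%:E).
  exact: (measurableT_comp men measurable_snd).
apply: (@le_lt_trans _ _ (\int[pi]_z ((enorm z.1)%:E + (enorm z.2)%:E))%E).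
  apply: ge0_le_integral => //.
  - by move=> z _; rewrite lee_fin edist_ge0.
  - by apply/measurable_EFinP; exact: measurable_edist_pair.
  - exact: emeasurable_funD.
  - by move=> z _; rewrite -EFinD lee_fin enormB.
rewrite ge0_integralD//; last 2 first.
- by move=> z _; rewrite lee_fin enorm_ge0.
- by move=> z _; rewrite lee_fin enorm_ge0.
rewrite (same_law_integral (f := fun t : Rd => (enorm t)%:E) _ _ law1)//.
rewrite (same_law_integral (f := fun t : Rd => (enorm t)%:E) _ _ law2)//.
exact: lte_add_pinfty.
Qed.

Lemma product_coupling (mu nu : probability Rd R) : coupling mu nu (mu \x nu)%E.
Proof.
move=> A mA; split.
  rewrite -[RHS]mule1 -(probability_setT nu); exact: product_measure1E.
rewrite -[RHS]mul1e -(probability_setT mu); exact: product_measure1E.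
Qed.

Lemma W1_ge0 (mu nu : set Rd -> \bar R) : (0 <= W1 edist mu nu)%E.
Proof.
apply: le_ereal_inf_tmp => _ [pi _ <-]; apply: integral_ge0 => z _.
by rewrite lee_fin edist_ge0.
Qed.

(** Near-optimal couplings stand in for an optimal one; they exist because the product coupling has
    finite cost. *)
Lemma W1_contraction (mu nu : probability Rd R) :
  finite_first_moment mu -> finite_first_moment nu ->
  (W1 edist (apply_kernel mu (K mu)) (apply_kernel nu (K nu))
   <= (Num.sqrt r + delta * CW)%:E * W1 edist mu nu)%E.
Proof.
move=> mu1 nu1; set c := Num.sqrt r + delta * CW.
have c0 : 0 <= c by rewrite addr_ge0 ?sqrtr_ge0// mulr_ge0// ltW.
have cp := product_coupling mu nu.
have wfin : W1 edist mu nu \is a fin_num.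
  rewrite ge0_fin_numE ?W1_ge0// (le_lt_trans _ (coupling_cost_lty cp mu1 nu1))//.
  by apply: ereal_inf_lbound; exists (mu \x nu)%E.
apply/lee_addgt0Pr => e e0.
(* Chosen so that c (e / (c + 1)) <= e; the summand 1 covers c = 0. *)
have e1 : 0 < e / (c + 1) by rewrite divr_gt0// ltr_wpDl.
have [_ [pi pimu <-] pile] := lb_ereal_inf_adherent e1 wfin.
rewrite -/(W1 edist mu nu) -(fineK wfin) -EFinD in pile.
apply: le_trans (W1_step_le pimu mu1 nu1 (ltW pile)) _.
rewrite -[in leRHS](fineK wfin) -EFinM -EFinD lee_fin mulrDr lerD2l.
rewrite mulrCA ler_piMr ?(ltW e0)// ler_pdivrMr ?mul1r ?lerDl//.
by rewrite ltr_wpDl.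
Qed.

Lemma tau1_le : (tau1 K <= (Num.sqrt r + delta * CW)%:E)%E.
Proof.
apply: ge_ereal_sup => _ [[mu nu] /= [mu1 nu1 _] <-].
have := W1_contraction mu1 nu1; set w' := W1 _ _ _; set w := W1 _ _ _.
have w0 : (0 <= w)%E by exact: W1_ge0.
have w'0 : (0 <= w')%E by exact: W1_ge0.
have c0 : 0 <= Num.sqrt r + delta * CW.
  by rewrite addr_ge0 ?sqrtr_ge0// mulr_ge0// ltW.
(* [tau1] excludes equal measures, not distance zero; at distance zero the contraction forces the
   numerator to vanish. *)
have [->|wn0] := eqVneq w 0%E.
  rewrite mule0 => w'le; have -> : w' = 0%E by apply/eqP; rewrite eq_le w'le.
  by rewrite mul0e lee_fin.
move: w w0 wn0 => [w| |] // w0 wn0 h; last by rewrite invey mule0; exact: c0.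
rewrite lee_fin in w0; rewrite eqe in wn0; rewrite inver (negPf wn0).
by rewrite lee_pdivrMr// lt_def wn0.
Qed.

(** An empty supremum would be -oo, so one admissible pair has to be exhibited: two Dirac masses at
    distinct points, available for d > 0. The sign makes all terms of the sum in the theorem
    nonnegative. *)
Lemma tau1_ge0 : (0 < d)%N -> (0 <= tau1 K)%E.
Proof.
move=> d0; pose x : Rd := const_mx 1.
have x0 : x != 0.
  apply/eqP => /rowP /(_ (Ordinal d0)); rewrite !mxE => /eqP.
  by rewrite oner_eq0.
have fm (a : Rd) : finite_first_moment (dirac a).
  rewrite /finite_first_moment integral_dirac ?diracT ?mul1e ?ltry//.
  by apply/measurable_EFinP; exact: measurable_enorm.
pose q (mu nu : probability Rd R) :=
  (W1 edist (apply_kernel mu (K mu)) (apply_kernel nu (K nu)) / W1 edist mu nu)%E.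
apply: le_ereal_sup_tmp; exists (q (dirac x) (dirac (0 : Rd))); last first.
  by rewrite /q mule_ge0 ?inve_ge0 ?W1_ge0.
exists (dirac x : probability Rd R, dirac (0 : Rd) : probability Rd R); last reflexivity.
split; [exact: fm|exact: fm|].
(* The Euclidean ball of radius 0 contains the origin only, so it separates the two masses. *)
exists [set y : Rd | enorm y \in `]-oo, 0%R] ].
  have := @measurable_enorm R d measurableT _ (measurable_itv `]-oo, (0 : R)]).
  by rewrite setTI.
rewrite /= !diracE [in X in _ != X]mem_set; last first.
  by rewrite /= enorm0 in_itv/= lexx.
rewrite memNset; first by rewrite eqe eq_sym oner_eq0.
rewrite /= in_itv/= => xle; move/eqP: x0; apply; apply: enorm_eq0.
by apply/eqP; rewrite eq_le xle enorm_ge0.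
Qed.

End mean_field_step.

(** * Fluctuations of the empirical interaction *)

Section fluctuation.
Context {R : realType} {d : nat}.
Local Notation Rd := ('rV[R]_d).
Context {W : Rd -> R} {CW : R} (LW : elipschitz CW (grad W)) (CW0 : 0 <= CW).
Context (eta : probability Rd R) (m : R) (m0 : 0 < m)
  (hm : (\int[eta]_x (enorm x ^+ 2)%:E <= m%:E)%E).
Context {N : nat} (N0 : (0 < N)%N).

Let mul_le_sqrD (x y : R) : x * y <= x ^+ 2 + y ^+ 2.
Proof. by have := sqr_ge0 (x - y); have := sqr_ge0 x; have := sqr_ge0 y; nra. Qed.

Let h (a z : Rd) : Rd := grad W (a - z) - grad_conv W eta a.

Let m1_le : (\int[eta]_x (enorm x)%:E <= (Num.sqrt m)%:E)%E.
Proof.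
by apply: integral_le_sqrt => //; [exact: measurable_enorm|exact: enorm_ge0].
Qed.

Lemma second_moment_finite_first_moment : finite_first_moment eta.
Proof. by rewrite /finite_first_moment (le_lt_trans m1_le)// ltry. Qed.

Let m1 := second_moment_finite_first_moment.

Let mconv : measurable_fun setT (grad_conv W eta).
Proof.
exact: (elipschitz_measurable (conv_law_lipschitz LW CW0 (@measurable_id _ _ setT) m1)).
Qed.

Let mgradW d' (E : measurableType d') (a z : E -> Rd) :
  measurable_fun setT a -> measurable_fun setT z ->
  measurable_fun setT (fun e => grad W (a e - z e)).
Proof.
move=> ma mz; apply: measurableT_comp (elipschitz_measurable LW) _.
exact: measurable_fun_rowB.
Qed.

Let mh d' (E : measurableType d') (a z : E -> Rd) :
  measurable_fun setT a -> measurable_fun setT z ->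
  measurable_fun setT (fun e => h (a e) (z e)).
Proof.
move=> ma mz; apply: measurable_fun_rowB; first exact: mgradW.
exact: (measurableT_comp mconv ma).
Qed.

Let intW (a : Rd) i : eta.-integrable setT (fun z => (grad W (a - z) 0 i)%:E).
Proof. exact: (integrable_gradW_shift LW CW0 a i (@measurable_id _ _ setT) m1). Qed.

Let h_int0 (a : Rd) i :
  eta.-integrable setT (fun z => (h a z 0 i)%:E) /\
  (\int[eta]_z (h a z 0 i)%:E = 0)%E.
Proof.
have E z : h a z 0 i = grad W (a - z) 0 i - grad_conv W eta a 0 i.
  by rewrite /h; move: (grad W _) (grad_conv _ _ _) => u v; rewrite !mxE.
have ic : eta.-integrable setT (EFin \o (fun=> grad_conv W eta a 0 i)).
  exact: finite_measure_integrable_cst.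
split.
  by under eq_fun do rewrite E EFinB; exact: integrableB.
under eq_integral do rewrite E EFinB.
rewrite integralB//= integral_prob_cst.
have -> : (\int[eta]_z (grad W (a - z) 0 i)%:E = (grad_conv W eta a 0 i)%:E)%E.
  by rewrite mxE /Rintegral fineK//; exact: integrable_fin_num.
by rewrite subee.
Qed.

(** As an average over [eta] of grad W (a - z) - grad W (a - x), the centred interaction is bounded
    independently of the position a. *)
Let h_le a z : enorm (h a z) <= CW * (enorm z + Num.sqrt m).
Proof.
have m0' : 0 <= Num.sqrt m by exact: sqrtr_ge0.
rewrite [h a z](_ : _ = \row_i \int[eta]_x (grad W (a - z) - grad W (a - x)) 0 i).
  apply: enorm_integral.
    by apply: measurable_fun_rowB => //; exact: mgradW.
  rewrite mulrDr.
  apply: (@le_trans _ _ (\int[eta]_x (CW * enorm z + CW * enorm x)%:E)%E).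
    apply: ge0_le_integral => //.
    - by move=> x _; rewrite lee_fin enorm_ge0.
    - apply/measurable_EFinP; apply: measurable_fun_enorm.
      by apply: measurable_fun_rowB => //; exact: mgradW.
    - apply/measurable_EFinP; apply: measurable_funD => //.
      by apply: measurable_funM => //; exact: measurable_enorm.
    - move=> x _; rewrite lee_fin -mulrDr.
      rewrite (le_trans (grad_shift_lipschitz_r LW z x a))// ler_wpM2l//.
      exact: enormB.
  apply: integral_affine_le => //.
  - exact: measurable_enorm.
  - exact: enorm_ge0.
  - by rewrite mulr_ge0// enorm_ge0.
apply/rowP => i; rewrite [RHS]mxE.
transitivity (\int[eta]_x (grad W (a - z) 0 i - grad W (a - x) 0 i)); last first.
  apply: eq_Rintegral => x _.
  by move: (grad W (a - z)) (grad W (a - x)) => u v; rewrite !mxE.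
rewrite RintegralB//; [|exact: finite_measure_integrable_cst|exact: intW].
have -> : \int[eta]_x grad W (a - z) 0 i = grad W (a - z) 0 i.
  by rewrite /Rintegral integral_prob_cst.
have -> : \int[eta]_x grad W (a - x) 0 i = grad_conv W eta a 0 i by rewrite mxE.
rewrite /h.
by move: (grad W (a - z)) (grad_conv W eta a) => u v; rewrite !mxE.
Qed.

Let H (i j : 'I_N) (y : N.-tuple Rd) := h (tnth y i) (tnth y j).

Let mt (j : 'I_N) : measurable_fun setT (fun y : N.-tuple Rd => tnth y j) :=
  @measurable_tnth _ Rd N j.

Let mH i j : measurable_fun setT (H i j).
Proof. exact: (mh (mt i) (mt j)). Qed.

(** A majorant of |H i j|^2 obtained from (p + q)^2 <= 2 p^2 + 2 q^2. Its mean is at most 4 CW^2 m,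
    the constant in [mean_field_fluctuation]. *)
Let b (j : 'I_N) (y : N.-tuple Rd) := 2 * CW ^+ 2 * m + 2 * CW ^+ 2 * enorm (tnth y j) ^+ 2.

Let H_sqr_le i j y : enorm (H i j y) ^+ 2 <= b j y.
Proof.
have c0 : 0 <= CW * (enorm (tnth y j) + Num.sqrt m).
  by rewrite mulr_ge0// addr_ge0 ?enorm_ge0 ?sqrtr_ge0.
apply: (@le_trans _ _ ((CW * (enorm (tnth y j) + Num.sqrt m)) ^+ 2)).
  by rewrite lerXn2r ?nnegrE ?enorm_ge0// h_le.
rewrite /b -[in leRHS](sqr_sqrtr (ltW m0)) -subr_ge0.
rewrite [leRHS](_ : _ = (CW * (enorm (tnth y j) - Num.sqrt m)) ^+ 2) ?sqr_ge0//.
ring.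
Qed.

Let mb j : measurable_fun setT (b j).
Proof.
apply: measurable_funD => //; apply: measurable_funM => //; apply: measurable_funX.
exact: (measurable_fun_enorm (mt j)).
Qed.

Let b_int j : (\int[pow_prob eta N]_y (b j y)%:E <= (4 * CW ^+ 2 * m)%:E)%E.
Proof.
have -> : 4 * CW ^+ 2 * m = 2 * CW ^+ 2 * m + 2 * CW ^+ 2 * m by ring.
have c0 : 0 <= 2 * CW ^+ 2 by rewrite mulr_ge0// sqr_ge0.
apply: (@integral_affine_le _ _ _ _ (fun y => enorm (tnth y j) ^+ 2)) => //.
- by apply: measurable_funX; exact: (measurable_fun_enorm (mt j)).
- by move=> y; rewrite sqr_ge0.
- by rewrite mulr_ge0// ltW.
rewrite (same_law_integral (f := fun x : Rd => (enorm x ^+ 2)%:E) _ _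
  (pow_prob_coord eta j))//.
by apply/measurable_EFinP; apply: measurable_funX; exact: measurable_enorm.
Qed.

Let g i j l y := dot (H i j y) (H i l y).

Let mg i j l : measurable_fun setT (g i j l).
Proof.
by apply: measurable_sum => k; apply: measurable_funM; exact: measurable_fun_coord.
Qed.

Let g_int i j l : (pow_prob eta N).-integrable setT (fun y => (g i j l y)%:E).
Proof.
apply: (@integrable_le _ _ _ _ _ (fun y => b j y + b l y)) => //.
- exact: measurable_funD.
- move=> y; have := H_sqr_le i j y; have := H_sqr_le i l y.
  have := dot_le_enorm (H i j y) (H i l y).
  have := dot_le_enorm (- H i j y) (H i l y).
  rewrite enormN -scaleN1r dotZl mulN1r -/(g i j l y) => h1 h2 bl bj.
  have gle : `|g i j l y| <= enorm (H i j y) * enorm (H i l y).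
    by rewrite ler_norml h2 andbT lerNl.
  apply: (le_trans gle); apply: le_trans (lerD bj bl); exact: mul_le_sqrD.
- under eq_integral do rewrite EFinD.
  have b0 k y : 0 <= b k y by rewrite (le_trans _ (H_sqr_le i k y))// sqr_ge0.
  rewrite ge0_integralD//.
  + by rewrite lte_add_pinfty// (le_lt_trans (b_int _))// ltry.
  + by move=> y _; rewrite lee_fin.
  + exact/measurable_EFinP.
  + by move=> y _; rewrite lee_fin.
  + exact/measurable_EFinP.
Qed.

(* Resample the l-th particle: conditionally on the others, H i l is centred. *)
Let g_cross i j l : l != i -> l != j ->
  (\int[pow_prob eta N]_y (g i j l y)%:E = 0)%E.
Proof.
move=> li lj.
have mG : measurable_fun setT (fun y => (g i j l y)%:E) by exact/measurable_EFinP.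
rewrite -(same_law_integral (@measurable_set_coord _ Rd N l) (@measurable_id _ _ setT)
  (pow_prob_resample eta l) mG).
have mG' : measurable_fun setT
    (fun z : N.-tuple Rd * Rd => (g i j l (set_coord l z))%:E).
  exact: (measurableT_comp mG (@measurable_set_coord _ Rd N l)).
have iG : (pow_prob eta N \x eta)%E.-integrable setT
    (fun z => (g i j l (set_coord l z))%:E).
  apply/integrableP; split => //.
  rewrite (same_law_integral (f := fun y => `|(g i j l y)%:E|%E)
    (@measurable_set_coord _ Rd N l) (@measurable_id _ _ setT)
    (pow_prob_resample eta l)); last exact: measurableT_comp.
  by have /integrableP[] := g_int i j l.
rewrite -integral12_prod_meas1//.
rewrite (eq_integral (cst 0%E)) ?integral0// => y _.
rewrite /fubini_F /=.
pose a := tnth y i; pose u := h a (tnth y j).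
have E x : g i j l (set_coord l (y, x)) = \sum_k u 0 k * h a x 0 k.
  have il : (i == l) = false by rewrite eq_sym; exact: negPf.
  have jl : (j == l) = false by rewrite eq_sym; exact: negPf.
  by rewrite /g /H !tnth_mktuple eqxx il jl.
under eq_integral do rewrite E -sumEFin.
rewrite integral_sum//; last first.
  move=> k; under eq_fun do rewrite EFinM; apply: integrableZl => //.
  by have [] := h_int0 a k.
rewrite big1// => k _; under eq_integral do rewrite EFinM.
have [ik k0] := h_int0 a k.
by rewrite integralZl// k0 mule0.
Qed.

Lemma measurable_fluctuation (i : 'I_N) :
  measurable_fun setT (fun y : N.-tuple Rd =>
    enorm (grad_conv W (empirical y) (tnth y i) - grad_conv W eta (tnth y i))).
Proof.
apply: measurable_fun_enorm; apply: measurable_fun_rowB.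
  under eq_fun do rewrite (grad_conv_empirical LW).
  apply: measurable_fun_rowZ; apply: measurable_fun_row_sum => j.
  exact: (mgradW (mt i) (mt j)).
exact: (measurableT_comp mconv (mt i)).
Qed.

(** The squared norm expands into N^2 products weighted by N^(-2): the N diagonal ones have mean at
    most 4 CW^2 m, the others mean 0. The self-interaction H i i is not centred, but it enters only
    squared or paired with a centred term. The summand 1 keeps the bound positive when CW = 0, as
    [integral_le_sqrt] requires. *)
Lemma mean_field_fluctuation (i : 'I_N) :
  (\int[pow_prob eta N]_y
     (enorm (grad_conv W (empirical y) (tnth y i) - grad_conv W eta (tnth y i)))%:E
   <= (Num.sqrt ((4 * CW ^+ 2 * m + 1) / N%:R))%:E)%E.
Proof.
have Np : 0 < N%:R :> R by rewrite ltr0n.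
have Nn0 : (N%:R : R) != 0 by rewrite gt_eqF.
have c0 : 0 <= 4 * CW ^+ 2 * m by rewrite !mulr_ge0// ?sqr_ge0// ltW.
pose D y := N%:R^-1 *: \sum_j H i j y.
have DE y : grad_conv W (empirical y) (tnth y i) - grad_conv W eta (tnth y i) = D y.
  rewrite (grad_conv_empirical LW) /D /H /h sumrB scalerBr; congr (_ - _).
  by rewrite sumr_const card_ord -[grad_conv _ _ _ *+ N]scaler_nat scalerA mulVf// scale1r.
under eq_integral do rewrite DE.
have mD : measurable_fun setT D.
  by apply: measurable_fun_rowZ; apply: measurable_fun_row_sum => j; exact: mH.
apply: integral_le_sqrt.
- exact: measurable_fun_enorm.
- by move=> y; exact: enorm_ge0.
- by rewrite divr_gt0// ltr_wpDl.
have D2 y : enorm (D y) ^+ 2 = \sum_j \sum_l N%:R^-2 * g i j l y.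
  rewrite enorm_sqr /D dotZl dotZr mulrA -expr2 -exprVn.
  have dotsl (F : 'I_N -> Rd) v : dot (\sum_j F j) v = \sum_j dot (F j) v.
    rewrite /dot exchange_big/=; apply: eq_bigr => k _.
    by rewrite summxE mulr_suml.
  rewrite dotsl mulr_sumr; apply: eq_bigr => j _.
  rewrite dotC dotsl mulr_sumr; apply: eq_bigr => l _.
  by rewrite dotC.
under eq_integral do (rewrite D2 -sumEFin; under eq_bigr do rewrite -sumEFin).
have ig j l : (pow_prob eta N).-integrable setT (fun y => (N%:R^-2 * g i j l y)%:E).
  by under eq_fun do rewrite EFinM; exact: integrableZl.
rewrite integral_sum//; last by move=> j; exact: integrable_sum.
apply: (@le_trans _ _ (\sum_(j < N) (N%:R^-2 * (4 * CW ^+ 2 * m))%:E)%E); last first.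
  rewrite sumEFin lee_fin sumr_const card_ord -[_ *+ N]mulr_natl.
  rewrite mulrA [N%:R * _](_ : _ = N%:R^-1); last by rewrite expr2 invfM mulVKf.
  by rewrite mulrC ler_wpM2r ?invr_ge0// lerDl.
apply: lee_sum => j _; rewrite integral_sum// (bigD1 j)//= big1 ?adde0; last first.
  move=> l lj; under eq_integral do rewrite EFinM.
  rewrite integralZl//.
  (* The distinct indices j and l cannot both be i; one that differs from i is resampled, after
     exchanging them if l = i. *)
  have [li|li] := eqVneq l i; last by rewrite g_cross ?mule0.
  rewrite (eq_integral (fun y => (g i l j y)%:E)); last first.
    by move=> y _; congr EFin; exact: dotC.
  by rewrite g_cross ?mule0// -?li eq_sym.
under eq_integral do rewrite EFinM.
rewrite integralZl// EFinM lee_wpmul2l ?lee_fin ?invr_ge0 ?sqr_ge0//.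
apply: le_trans (b_int j); apply: ge0_le_integral => //.
- by move=> y _; rewrite lee_fin /g -enorm_sqr sqr_ge0.
- exact/measurable_EFinP.
- exact/measurable_EFinP.
- by move=> y _; rewrite lee_fin /g -enorm_sqr.
Qed.

End fluctuation.

(** * Second-moment recursion *)

Section second_moment.
Context {R : realType}.

(** If a + b < 1, put c = 1 - a - b: convexity of the square with weights a, b, c at u, v, w / c
    gives ra = a, rb = b, k = 1 / c, so the factor ra + rb stays below 1. Otherwise only finiteness
    at each step matters, and (p + q + w)^2 <= 3 (p^2 + q^2 + w^2) is enough. *)
Lemma sqr_affine_le (a b : R) : 0 <= a -> 0 <= b -> exists ra rb k : R,
  [/\ 0 <= ra, 0 <= rb, 0 <= k, (a + b < 1 -> ra + rb < 1) &
      forall u v w : R, (a * u + b * v + w) ^+ 2 <= ra * u ^+ 2 + rb * v ^+ 2 + k * w ^+ 2].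
Proof.
move=> a0 b0; have [ab|ab] := ltP (a + b) 1; last first.
  exists (3 * a ^+ 2), (3 * b ^+ 2), 3; split => //; rewrite ?mulr_ge0 ?sqr_ge0//.
  move=> u v w; rewrite -subr_ge0.
  rewrite [leRHS](_ : _ = (a * u - b * v) ^+ 2 + (a * u - w) ^+ 2 + (b * v - w) ^+ 2).
    by rewrite !addr_ge0 ?sqr_ge0.
  ring.
pose c := 1 - (a + b); have c0 : 0 < c by rewrite subr_gt0.
exists a, b, c^-1; split; rewrite ?invr_ge0 ?(ltW c0)// => u v w.
pose t := w / c; have wE : w = c * t by rewrite /t mulrC divfK// gt_eqF.
rewrite wE [c^-1 * _](_ : _ = c * t ^+ 2); last by field; rewrite gt_eqF.
have ca : c = 1 - a - b by rewrite /c; ring.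
rewrite -subr_ge0 [leRHS](_ : _ = a * b * (u - v) ^+ 2 + a * c * (u - t) ^+ 2
                                + b * c * (v - t) ^+ 2).
  by rewrite !addr_ge0// mulr_ge0 ?sqr_ge0// mulr_ge0// ltW.
rewrite ca; ring.
Qed.

Lemma sqr_mean_le (I : finType) (f : I -> R) : (0 < #|I|)%N ->
  (#|I|%:R^-1 * \sum_i f i) ^+ 2 <= #|I|%:R^-1 * \sum_i f i ^+ 2.
Proof.
move=> I0; set n : R := #|I|%:R; set t := n^-1 * _.
have n0 : 0 < n by rewrite ltr0n.
have st : \sum_i f i = n * t by rewrite /t mulVKf// gt_eqF.
(* The empirical variance is nonnegative. *)
have : 0 <= \sum_i (f i - t) ^+ 2 by apply: sumr_ge0 => i _; exact: sqr_ge0.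
rewrite (eq_bigr (fun i => f i ^+ 2 - 2 * t * f i + t ^+ 2)); last by move=> i _; ring.
rewrite big_split/= sumrB -mulr_sumr sumr_const -[t ^+ 2 *+ _]mulr_natl -/n st => h.
rewrite -(ler_pM2l n0) mulVKf ?gt_eqF// -subr_ge0 (le_trans h)// le_eqVlt.
by apply/orP; left; apply/eqP; ring.
Qed.

(** Covers both dynamics: U is the norm of the current position and U' the size of the interacting
    cloud, namely the constant sqrt m for the mean-field flow and the average norm for the
    particles. The noise is not treated as centred; its norm joins [kappa] in the third slot of the
    quadratic bound. *)
Lemma noisy_second_moment d1 d2 (E : measurableType d1) (F : measurableType d2) d
    (Q : probability E R) (Z : probability F R)
    (D : E -> 'rV[R]_d) (n : F -> 'rV[R]_d) (U U' : E -> R)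
    (a b kappa s m G ra rb k : R) :
  measurable_fun setT D -> measurable_fun setT n ->
  measurable_fun setT U -> measurable_fun setT U' ->
  0 <= ra -> 0 <= rb -> 0 <= k -> 0 <= kappa -> 0 <= s ->
  (forall e, enorm (D e) <= a * U e + b * U' e + kappa) ->
  (\int[Q]_e (U e ^+ 2)%:E <= m%:E)%E -> (\int[Q]_e (U' e ^+ 2)%:E <= m%:E)%E ->
  (\int[Z]_z (enorm (n z) ^+ 2)%:E <= G%:E)%E ->
  (forall u v w : R, (a * u + b * v + w) ^+ 2 <= ra * u ^+ 2 + rb * v ^+ 2 + k * w ^+ 2) ->
  (\int[Q \x Z]_p (enorm (D p.1 + s *: n p.2) ^+ 2)%:E
   <= ((ra + rb) * m + k * (2 * kappa ^+ 2 + 2 * s ^+ 2 * G))%:E)%E.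
Proof.
move=> mD mn mU mU' ra0 rb0 k0 ka0 s0 DU Um U'm nG abk.
have mn2 : measurable_fun setT (fun z => enorm (n z) ^+ 2).
  by apply: measurable_funX; exact: measurable_fun_enorm.
have mU2 : measurable_fun setT (fun e => U e ^+ 2) by exact: measurable_funX.
have mU'2 : measurable_fun setT (fun e => U' e ^+ 2) by exact: measurable_funX.
pose f1 e := ra * U e ^+ 2 + rb * U' e ^+ 2.
pose f2 z := 2 * k * kappa ^+ 2 + 2 * k * s ^+ 2 * enorm (n z) ^+ 2.
have f10 e : 0 <= f1 e by rewrite addr_ge0// mulr_ge0 ?sqr_ge0//.
have f20 z : 0 <= f2 z by rewrite addr_ge0 ?mulr_ge0 ?sqr_ge0 ?enorm_ge0//.
have mf1 : measurable_fun setT f1.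
  by apply: measurable_funD; exact: measurable_funM.
have mf2 : measurable_fun setT f2.
  by apply: measurable_funD => //; exact: measurable_funM.
have mp1 : measurable_fun setT (fun p : E * F => (f1 p.1)%:E).
  by apply/measurable_EFinP; exact: measurableT_comp.
have mp2 : measurable_fun setT (fun p : E * F => (f2 p.2)%:E).
  by apply/measurable_EFinP; exact: measurableT_comp.
apply: (@le_trans _ _ (\int[Q \x Z]_p ((f1 p.1)%:E + (f2 p.2)%:E))%E).
  apply: ge0_le_integral => //.
  - by move=> p _; rewrite lee_fin sqr_ge0.
  - apply/measurable_EFinP; apply: measurable_funX; apply: measurable_fun_enorm.
    apply: measurable_fun_rowD; first exact: (measurableT_comp mD).
    by apply: measurable_fun_rowZ; exact: (measurableT_comp mn).
  - exact: emeasurable_funD.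
  - move=> p _; rewrite -EFinD lee_fin.
    pose w := kappa + s * enorm (n p.2).
    have nw : enorm (D p.1 + s *: n p.2) <= a * U p.1 + b * U' p.1 + w.
      by rewrite (le_trans (enormD _ _))// enormZ ger0_norm// addrA lerD2r.
    apply: (@le_trans _ _ ((a * U p.1 + b * U' p.1 + w) ^+ 2)).
      by rewrite lerXn2r ?nnegrE ?enorm_ge0// (le_trans _ nw)// enorm_ge0.
    apply: le_trans (abk _ _ _) _; rewrite lerD2l /f2 -subr_ge0.
    rewrite [leRHS](_ : _ = k * (kappa - s * enorm (n p.2)) ^+ 2).
      by rewrite mulr_ge0 ?sqr_ge0//.
    rewrite /w; ring.
rewrite ge0_integralD//; last 2 first.
- by move=> p _; rewrite lee_fin.
- by move=> p _; rewrite lee_fin.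
rewrite (integral_prod_fst Q Z (f := fun e => (f1 e)%:E))//; last exact/measurable_EFinP.
rewrite (integral_prod_snd Q Z (f := fun e => (f2 e)%:E))//; last exact/measurable_EFinP.
rewrite EFinD leeD//.
- under eq_integral do rewrite EFinD !EFinM.
  rewrite ge0_integralD//; last 4 first.
  + by move=> e _; rewrite mule_ge0 ?lee_fin ?sqr_ge0.
  + by apply: measurable_funeM; exact/measurable_EFinP.
  + by move=> e _; rewrite mule_ge0 ?lee_fin ?sqr_ge0.
  + by apply: measurable_funeM; exact/measurable_EFinP.
  rewrite mulrDl EFinD !EFinM leeD//.
  + rewrite ge0_integralZl//; [by rewrite lee_wpmul2l|exact/measurable_EFinP|].
    by move=> e _; rewrite lee_fin sqr_ge0.
  + rewrite ge0_integralZl//; [by rewrite lee_wpmul2l|exact/measurable_EFinP|].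
    by move=> e _; rewrite lee_fin sqr_ge0.
- have -> : k * (2 * kappa ^+ 2 + 2 * s ^+ 2 * G) =
      2 * k * kappa ^+ 2 + 2 * k * s ^+ 2 * G by ring.
  apply: integral_affine_le => //.
  + by move=> z; rewrite sqr_ge0.
  + by rewrite !mulr_ge0 ?sqr_ge0//.
  + by rewrite !mulr_ge0 ?sqr_ge0//.
Qed.

End second_moment.

(** * Synchronous coupling of the particles with i.i.d. mean-field copies *)

Section coupled_chain.
Context {R : realType} {d : nat}.
Local Notation Rd := ('rV[R]_d).
Context {delta : R} {V W : Rd -> R} {lV lW CV CW : R}.
Context (delta0 : 0 < delta) (dV : twice_differentiable V)
  (dW : twice_differentiable W) (hV : forall x, mx_ge (hess V x) lV)
  (hW : forall x, mx_ge (hess W x) lW) (LV : elipschitz CV (grad V))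
  (LW : elipschitz CW (grad W)) (CV0 : 0 <= CV) (CW0 : 0 <= CW).

Let r := 1 - 2 * delta * (lV + lW) + delta ^+ 2 * (CV + CW) ^+ 2.
Local Notation K := (em_kernel delta V W).
Local Notation drift := (@em_drift R d delta V W).
Local Notation s := (Num.sqrt (2 * delta)).
Local Notation noise := (@noise R d).
Let a := Num.sqrt r.
Let b := delta * CW.
(** Bounds the drift at the origin when all the mass sits there. *)
Let kappa := delta * enorm (grad V 0) + delta * enorm (grad W 0).

Let a0 : 0 <= a. Proof. exact: sqrtr_ge0. Qed.
Let b0 : 0 <= b. Proof. by rewrite mulr_ge0// ltW. Qed.

Let enorm_le_kappa (u p q : Rd) k : enorm (u - (0 - delta *: p - delta *: q)) <= k ->
  enorm u <= k + (delta * enorm p + delta * enorm q).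
Proof.
move=> h; rewrite -[u](subrK (0 - delta *: p - delta *: q)).
rewrite (le_trans (enormD _ _))// lerD// sub0r -opprD enormN.
by rewrite (le_trans (enormD _ _))// !enormZ gtr0_norm.
Qed.

(** Growth is a case of the distance estimate: the comparison is with a particle at 0 whose
    interaction variable is constantly 0. *)
Lemma em_drift_growth (mu : probability Rd R) (k : R) x :
  (\int[mu]_z (enorm z)%:E <= k%:E)%E ->
  enorm (drift mu x) <= a * enorm x + b * k + kappa.
Proof.
move=> muk; apply: enorm_le_kappa.
have law : same_law mu mu id id by [].
have c0 : conv_law (W := W) mu (cst 0) 0 = grad W 0.
  apply/rowP => i; rewrite [LHS]mxE /Rintegral.
  rewrite (eq_integral (fun=> (grad W 0 0 i)%:E)) ?integral_prob_cst//.
  by move=> z _; rewrite subr0.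
rewrite -c0 (em_drift_law LW x _ law)// -[in leRHS](subr0 x).
apply: (drift_dist_law delta0 dV dW hV hW LV LW) => //.
- by rewrite (le_lt_trans muk)// ltry.
- by rewrite /cst; under eq_integral do rewrite enorm0; rewrite integral0 ltry.
- by under eq_integral do rewrite /edist subr0.
Qed.

Lemma em_drift_empirical_growth N (N0 : (0 < N)%N) (x : N.-tuple Rd) i :
  enorm (drift (empirical x) (tnth x i)) <=
  a * enorm (tnth x i) + b * (N%:R^-1 * \sum_(j < N) enorm (tnth x j)) + kappa.
Proof.
apply: enorm_le_kappa.
pose o : N.-tuple Rd := [tuple 0 | _ < N].
have := em_drift_empirical_dist delta0 dV dW hV hW LV LW CV0 CW0 N0 x o i.
rewrite tnth_mktuple {1 2}/edist subr0.
under eq_bigr do rewrite /edist tnth_mktuple subr0.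
suff -> : drift (empirical o) 0 = 0 - delta *: grad V 0 - delta *: grad W 0 by [].
rewrite /em_drift (grad_conv_empirical LW); congr (_ - _ *: _).
rewrite (eq_bigr (fun=> grad W 0)); last by move=> j _; rewrite tnth_mktuple subr0.
rewrite sumr_const card_ord -[grad W 0 *+ N]scaler_nat scalerA mulVf ?scale1r//.
by rewrite pnatr_eq0 -lt0n.
Qed.

Lemma same_law_box d1 d2 (E1 : measurableType d1) (E2 : measurableType d2)
    d3 (T : measurableType d3) N (P1 : probability E1 R) (P2 : probability E2 R)
    (X : E1 -> N.-tuple T) (Y : E2 -> N.-tuple T) :
  measurable_fun setT X -> measurable_fun setT Y ->
  (forall B, (forall i, measurable (B i)) -> P1 (X @^-1` box B) = P2 (Y @^-1` box B)) ->
  same_law P1 P2 X Y.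
Proof.
move=> mX mY XY A mA.
pose X' : {mfun E1 >-> N.-tuple T} := HB.pack X (isMeasurableFun.Build _ _ _ _ X mX).
pose Y' : {mfun E2 >-> N.-tuple T} := HB.pack Y (isMeasurableFun.Build _ _ _ _ Y mY).
exact: (box_unique (m1 := distribution P1 X') (m2 := distribution P2 Y') XY mA).
Qed.

Context (G : R) (hG : (\int[noise]_z (enorm (noise_row z) ^+ 2)%:E <= G%:E)%E).
Context (ra rb k : R) (ra0 : 0 <= ra) (rb0 : 0 <= rb) (k0 : 0 <= k)
  (abk : forall u v w : R,
     (a * u + b * v + w) ^+ 2 <= ra * u ^+ 2 + rb * v ^+ 2 + k * w ^+ 2).

Definition moment_source : R := k * (2 * kappa ^+ 2 + 2 * s ^+ 2 * G).

Let kappa0 : 0 <= kappa.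
Proof. by rewrite addr_ge0// mulr_ge0 ?enorm_ge0// ltW. Qed.

Let msq : measurable_fun setT (fun x : Rd => (enorm x ^+ 2)%:E).
Proof. by apply/measurable_EFinP; apply: measurable_funX; exact: measurable_enorm. Qed.

Lemma second_moment_step (eta eta' : probability Rd R) (m : R) : 0 < m ->
  (forall A, measurable A -> eta' A = apply_kernel eta (K eta) A) ->
  (\int[eta]_x (enorm x ^+ 2)%:E <= m%:E)%E ->
  (\int[eta']_x (enorm x ^+ 2)%:E <= ((ra + rb) * m + moment_source)%:E)%E.
Proof.
move=> m0 step hm.
have m1 := second_moment_finite_first_moment m0 hm.
have md : measurable_fun setT (drift eta) := measurable_em_drift LV LW CW0 m1.
pose X (p : Rd * d.-tuple (measurableTypeR R)) := drift eta p.1 + s *: noise_row p.2.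
have mX : measurable_fun setT X by exact: measurable_fun_add_noise.
have law : same_law (eta \x noise)%E eta' X id.
  move=> A mA; rewrite preimage_id step//.
  exact: (mean_field_step_law LV LW CW0 mA (@measurable_id _ _ setT) _ m1).
rewrite -(same_law_integral mX (@measurable_id _ _ setT) law msq).
apply: (noisy_second_moment (a := a) (b := b) (kappa := kappa)
  (U := @enorm R d) (U' := cst (Num.sqrt m))) => //.
- exact: measurable_noise_row.
- exact: measurable_enorm.
- move=> x; apply: em_drift_growth.
  by apply: integral_le_sqrt => //; [exact: measurable_enorm|exact: enorm_ge0].
- rewrite (eq_integral (fun=> m%:E)) ?integral_prob_cst// => z _.
  by rewrite /= sqr_sqrtr// ltW.
Qed.

Context (eta : nat -> probability Rd R) (eta_step : mean_field_dynamics K eta)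
  (m : nat -> R) (m_gt0 : forall n, 0 < m n)
  (m_le : forall n, (\int[eta n]_x (enorm x ^+ 2)%:E <= (m n)%:E)%E)
  (mS : forall n, m n.+1 = (ra + rb) * m n + moment_source).
(** u n / sqrt N will bound the mean distance after n steps: a + b is the contraction factor, and
    the source is delta times the fluctuation bound with N^(-1/2) taken out. *)
Context (u : nat -> R) (u0 : u 0%N = 0)
  (uS : forall n, u n.+1 = (a + b) * u n + delta * Num.sqrt (4 * CW ^+ 2 * m n + 1)).

Context {N : nat} (N0 : (0 < N)%N) d' (Omega : measurableType d')
  (P : probability Omega R) (X : nat -> 'I_N -> {RV P >-> Rd})
  (X_dyn : particle_dynamics X K (eta 0%N)).

Lemma measurable_config n : measurable_fun setT (config X n).
Proof.
apply/measurable_fun_tnthP => i.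
rewrite (_ : _ \o _ = X n i); first exact: measurable_funP.
by apply/funext => w /=; rewrite tnth_mktuple.
Qed.

Lemma config_box n (B : 'I_N -> set Rd) :
  config X n @^-1` box B = \bigcap_(i in [set: 'I_N]) (X n i @^-1` B i).
Proof.
apply/seteqP; split => [w h i _|w h i]; first by have := h i; rewrite tnth_mktuple.
by rewrite tnth_mktuple; exact: (h i I).
Qed.

(** Only the law of [x] at time n is matched with the given particles, so the space may change at
    every step. The moment bound for [x] travels with the coupling, which makes it available for
    [particle_second_moment]. *)
Record coupled n d0 (E : measurableType d0) (Q : probability E R)
    (x y : E -> N.-tuple Rd) : Prop := Coupled {
  coupled_mx : measurable_fun setT x;
  coupled_my : measurable_fun setT y;
  coupled_lawx : same_law Q P x (config X n);
  coupled_lawy : same_law Q (pow_prob (eta n) N) y id;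
  coupled_dist : forall i,
    (\int[Q]_e (edist (tnth (x e) i) (tnth (y e) i))%:E <= (u n / Num.sqrt N%:R)%:E)%E;
  coupled_moment : forall i,
    (\int[Q]_e (enorm (tnth (x e) i) ^+ 2)%:E <= (m n)%:E)%E }.

Lemma coupled0 : coupled 0 (pow_prob (eta 0%N) N) id id.
Proof.
split => //.
- apply: same_law_box => //; first exact: measurable_config.
  by move=> B mB; rewrite preimage_id pow_prob_box// config_box X_dyn.1.
- move=> i; rewrite u0 mul0r; under eq_integral do rewrite /edist subrr enorm0.
  by rewrite integral0.
- move=> i; rewrite (same_law_integral _ _ (pow_prob_coord (eta 0%N) i) msq)//.
  exact: measurable_tnth.
Qed.

Section step.
Context n d0 (E : measurableType d0) (Q : probability E R) (x y : E -> N.-tuple Rd)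
  (xy : coupled n Q x y).
Local Notation noises := (N.-tuple (d.-tuple (measurableTypeR R))).

Let fm : finite_first_moment (eta n).
Proof. exact: second_moment_finite_first_moment (m_gt0 n) (m_le n). Qed.

Let Dx (i : 'I_N) (e : E) := drift (empirical (x e)) (tnth (x e) i).
Let Dy (i : 'I_N) (e : E) := drift (eta n) (tnth (y e) i).

Let mxi i : measurable_fun setT (fun e => tnth (x e) i).
Proof. exact: (measurableT_comp (@measurable_tnth _ Rd N i) (coupled_mx xy)). Qed.

Let myi i : measurable_fun setT (fun e => tnth (y e) i).
Proof. exact: (measurableT_comp (@measurable_tnth _ Rd N i) (coupled_my xy)). Qed.

Let mDx i : measurable_fun setT (Dx i).
Proof.
exact: (measurableT_comp (measurable_em_drift_empirical LV LW i) (coupled_mx xy)).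
Qed.

Let mdrift : measurable_fun setT (drift (eta n)).
Proof. exact: (measurable_em_drift LV LW CW0 fm). Qed.

Let mDy i : measurable_fun setT (Dy i).
Proof. exact: (measurableT_comp mdrift (myi i)). Qed.

Let next (D : 'I_N -> E -> Rd) (p : E * noises) : N.-tuple Rd :=
  [tuple D i p.1 + s *: noise_row (tnth p.2 i) | i < N].

Let tnth_next D p i : tnth (next D p) i = D i p.1 + s *: noise_row (tnth p.2 i).
Proof. exact: tnth_mktuple. Qed.

Let next_dist D D' p i :
  edist (tnth (next D p) i) (tnth (next D' p) i) = edist (D i p.1) (D' i p.1).
Proof. by rewrite !tnth_next edist_addr. Qed.

Let mnext D : (forall i, measurable_fun setT (D i)) -> measurable_fun setT (next D).
Proof.
move=> mD; apply/measurable_fun_tnthP => i.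
rewrite (_ : _ \o _ = fun p : E * noises => D i p.1 + s *: noise_row (tnth p.2 i)).
  apply: measurable_fun_rowD; first exact: (measurableT_comp (mD i)).
  apply: measurable_fun_rowZ; apply: (measurableT_comp measurable_noise_row).
  exact: (measurableT_comp
    (@measurable_tnth _ (d.-tuple (measurableTypeR R)) N i) measurable_snd).
by apply/funext => p /=; rewrite tnth_mktuple.
Qed.

Let next_box D B : (forall i, measurable_fun setT (D i)) ->
  (forall i, measurable (B i)) ->
  (Q \x pow_prob noise N)%E (next D @^-1` box B) =
  (\int[Q]_e \prod_(i < N) gauss (D i e) (2 * delta) (B i))%E.
Proof.
move=> mD mB; rewrite -(add_noises_law Q (2 * delta) mB mD); congr (_ _).
apply/seteqP; split => p h i; first by have := h i; rewrite tnth_mktuple.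
by rewrite tnth_mktuple; exact: h.
Qed.

Let lawx : same_law (Q \x pow_prob noise N)%E P (next Dx) (config X n.+1).
Proof.
apply: same_law_box; [exact: mnext|exact: measurable_config|move=> B mB].
(* The conditional clause is applied to the sure event as history, since only the law at time n + 1
   is wanted. *)
rewrite [LHS]next_box// config_box -[X in P X]setTI X_dyn.2//; last first.
  exact: (@measurableT _ (g_sigma_algebraType _)).
pose f (t : N.-tuple Rd) :=
  (\prod_(i < N) gauss (drift (empirical t) (tnth t i)) (2 * delta) (B i))%E.
have mf : measurable_fun setT f.
  apply: emeasurable_fun_prod => i.
  have mDe : measurable_fun setT
    (fun t : N.-tuple Rd => drift (empirical t) (tnth t i)).
    exact: (measurable_em_drift_empirical LV LW i).
  exact: (measurable_gauss (2 * delta) (mB i) mDe).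
transitivity (\int[Q]_e f (x e))%E => //.
rewrite (same_law_integral (coupled_mx xy) (measurable_config n) (coupled_lawx xy) mf).
by apply: eq_integral => w _; apply: eq_bigr => i _; rewrite tnth_mktuple.
Qed.

(** The copies stay independent because their drift uses the deterministic law [eta n], not their
    empirical measure: the integrand factors over the coordinates. *)
Let lawy : same_law (Q \x pow_prob noise N)%E (pow_prob (eta n.+1) N) (next Dy) id.
Proof.
apply: same_law_box => //; first exact: mnext.
move=> B mB; rewrite [LHS]next_box// preimage_id pow_prob_box//.
pose f i z := gauss (drift (eta n) z) (2 * delta) (B i).
have mf i : measurable_fun setT (f i).
  exact: (measurable_gauss (2 * delta) (mB i) mdrift).
have mpf : measurable_fun setT
    (fun t : N.-tuple Rd => \prod_(i < N) f i (tnth t i))%E.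
  by apply: emeasurable_fun_prod => i; exact: (measurableT_comp (mf i) (@measurable_tnth _ Rd N i)).
transitivity (\int[Q]_e (fun t : N.-tuple Rd => \prod_(i < N) f i (tnth t i)) (y e))%E => //.
rewrite (same_law_integral (coupled_my xy) (@measurable_id _ _ setT) (coupled_lawy xy) mpf).
rewrite integral_pow_prob_prod//.
by apply: eq_bigr => i _; rewrite eta_step.
Qed.

Let sub_cancel (z p q : Rd) : z - p - (z - q) = q - p.
Proof. by rewrite opprB addrC addrA subrK. Qed.

(** The intermediate point is the particle drift evaluated at the copies y. Stability of the
    particle drift handles the first half; in the second half only the convolutions differ. *)
Let Dxy_le i e : edist (Dx i e) (Dy i e) <=
  a * edist (tnth (x e) i) (tnth (y e) i)
  + b * (N%:R^-1 * \sum_(j < N) edist (tnth (x e) j) (tnth (y e) j))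
  + delta * enorm (grad_conv W (empirical (y e)) (tnth (y e) i)
                   - grad_conv W (eta n) (tnth (y e) i)).
Proof.
apply: le_trans (edist_tri (drift (empirical (y e)) (tnth (y e) i)) _ _) _.
apply: lerD; first exact: (em_drift_empirical_dist delta0 dV dW hV hW LV LW).
by rewrite /edist /em_drift sub_cancel -scalerBr enormZ gtr0_norm// -enormN opprB.
Qed.

Let distx i : (\int[Q \x pow_prob noise N]_p
  (edist (tnth (next Dx p) i) (tnth (next Dy p) i))%:E
  <= (u n.+1 / Num.sqrt N%:R)%:E)%E.
Proof.
pose v := u n / Num.sqrt N%:R.
pose dist j e := edist (tnth (x e) j) (tnth (y e) j).
pose fl e := enorm (grad_conv W (empirical (y e)) (tnth (y e) i)
                   - grad_conv W (eta n) (tnth (y e) i)).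
have mdist j : measurable_fun setT (dist j).
  apply: measurable_fun_enorm; exact: (measurable_fun_rowB (mxi j) (myi j)).
have mflt : measurable_fun setT (fun t : N.-tuple Rd =>
    enorm (grad_conv W (empirical t) (tnth t i) - grad_conv W (eta n) (tnth t i))).
  exact: measurable_fluctuation.
have mfl : measurable_fun setT fl by exact: (measurableT_comp mflt (coupled_my xy)).
(* The fluctuation involves y alone, so it can be computed under the i.i.d. law of y. *)
have flle : (\int[Q]_e (fl e)%:E <=
    (Num.sqrt (4 * CW ^+ 2 * m n + 1) / Num.sqrt N%:R)%:E)%E.
  rewrite (same_law_integral (coupled_my xy) (@measurable_id _ _ setT)
    (coupled_lawy xy) ((measurable_EFinP _ _).2 mflt)).
  apply: le_trans (mean_field_fluctuation LW CW0 (m_gt0 n) (m_le n) N0 i) _.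
  rewrite lee_fin sqrtrM ?sqrtrV ?ler0n// addr_ge0// !mulr_ge0 ?sqr_ge0//.
  exact/ltW/m_gt0.
rewrite (eq_integral (fun p => (edist (Dx i p.1) (Dy i p.1))%:E)); last first.
  by move=> p _; rewrite next_dist.
have mDxy : measurable_fun setT (fun e => (edist (Dx i e) (Dy i e))%:E).
  apply/measurable_EFinP; apply: measurable_fun_enorm.
  exact: (measurable_fun_rowB (mDx i) (mDy i)).
rewrite (integral_prod_fst Q _ (f := fun e => (edist (Dx i e) (Dy i e))%:E))//; last first.
  by move=> e; rewrite lee_fin edist_ge0.
have dist0 j e : 0 <= dist j e by exact: edist_ge0.
have fl0 e : 0 <= fl e by exact: enorm_ge0.
apply: (@le_trans _ _ (\int[Q]_e (a%:E * (dist i e)%:E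
   + \sum_(j < N) (b / N%:R)%:E * (dist j e)%:E + delta%:E * (fl e)%:E))%E).
  apply: ge0_le_integral => //.
  - by move=> e _; rewrite lee_fin edist_ge0.
  - apply: emeasurable_funD; last by apply: measurable_funeM; exact/measurable_EFinP.
    apply: emeasurable_funD; first by apply: measurable_funeM; exact/measurable_EFinP.
    by apply: emeasurable_sum => j; apply: measurable_funeM; exact/measurable_EFinP.
  - move=> e _; under eq_bigr do rewrite -EFinM.
    rewrite sumEFin -!EFinM -!EFinD lee_fin -mulr_sumr -mulrA; exact: Dxy_le.
have bN0 : 0 <= b / N%:R by rewrite divr_ge0.
have m1 : measurable_fun setT (fun e => a%:E * (dist i e)%:E)%E.
  by apply: measurable_funeM; exact/measurable_EFinP.
have m2 j : measurable_fun setT (fun e => (b / N%:R)%:E * (dist j e)%:E)%E.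
  by apply: measurable_funeM; exact/measurable_EFinP.
have m3 : measurable_fun setT (fun e => delta%:E * (fl e)%:E)%E.
  by apply: measurable_funeM; exact/measurable_EFinP.
have p1 e : (0 <= a%:E * (dist i e)%:E)%E by rewrite mule_ge0 ?lee_fin.
have p2 j e : (0 <= (b / N%:R)%:E * (dist j e)%:E)%E by rewrite mule_ge0 ?lee_fin.
have p3 e : (0 <= delta%:E * (fl e)%:E)%E by rewrite mule_ge0 ?lee_fin// ltW.
have m12 : measurable_fun setT
    (fun e => a%:E * (dist i e)%:E + \sum_(j < N) (b / N%:R)%:E * (dist j e)%:E)%E.
  by apply: emeasurable_funD => //; exact: emeasurable_sum.
have ps e : (0 <= \sum_(j < N) (b / N%:R)%:E * (dist j e)%:E)%E.
  by apply: sume_ge0 => j _.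
rewrite ge0_integralD//; last by move=> e _; rewrite adde_ge0.
rewrite ge0_integralD//; last exact: emeasurable_sum.
rewrite ge0_integral_sum//.
have Z (f0 : E -> R) (q k0' : R) : measurable_fun setT f0 -> (forall e, 0 <= f0 e) ->
    0 <= q -> (\int[Q]_e (f0 e)%:E <= k0'%:E)%E ->
    (\int[Q]_e (q%:E * (f0 e)%:E) <= (q * k0')%:E)%E.
  move=> mf0 f00 q0 h; rewrite ge0_integralZl//; last 2 first.
  - exact/measurable_EFinP.
  - by move=> e _; rewrite lee_fin.
  by rewrite EFinM lee_wpmul2l// lee_fin.
have -> : u n.+1 / Num.sqrt N%:R = a * v + \sum_(j < N) (b / N%:R) * v
    + delta * (Num.sqrt (4 * CW ^+ 2 * m n + 1) / Num.sqrt N%:R).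
  (* The distance bound is the same for all particles, so averaging over j keeps it. *)
  have -> : \sum_(j < N) (b / N%:R) * v = b * v.
    have Nn0 : (N%:R : R) != 0 by rewrite pnatr_eq0 -lt0n.
    by rewrite sumr_const card_ord -[_ * _ *+ N]mulr_natl; field.
  rewrite uS /v; move: (Num.sqrt N%:R) (Num.sqrt (_ + 1)) => p q; ring.
rewrite !EFinD -sumEFin; apply: leeD; last by apply: Z => //; rewrite ltW.
apply: leeD; first by apply: Z => //; exact: (coupled_dist xy).
by apply: lee_sum => j _; apply: Z => //; exact: (coupled_dist xy).
Qed.

Let momentx i : (\int[Q \x pow_prob noise N]_p
  (enorm (tnth (next Dx p) i) ^+ 2)%:E <= (m n.+1)%:E)%E.
Proof.
pose U e := enorm (tnth (x e) i).
pose U' e := N%:R^-1 * \sum_(j < N) enorm (tnth (x e) j).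
have mU j : measurable_fun setT (fun e => enorm (tnth (x e) j)).
  exact: measurable_fun_enorm.
have mnz : measurable_fun setT (fun z : noises => noise_row (tnth z i)).
  exact: (measurableT_comp measurable_noise_row
    (@measurable_tnth _ (d.-tuple (measurableTypeR R)) N i)).
have mU' : measurable_fun setT U'.
  by apply: measurable_funM => //; exact: measurable_sum.
under eq_integral do rewrite (tnth_next Dx).
rewrite mS; apply: (noisy_second_moment (a := a) (b := b) (kappa := kappa)
  (D := Dx i) (n := fun z => noise_row (tnth z i)) (U := U) (U' := U')) => //.
- exact: (mU i).
- by move=> e; exact: em_drift_empirical_growth.
- exact: (coupled_moment xy).
(* Jensen for the average over the particles, which share one moment bound. *)
- apply: (@le_trans _ _ (\int[Q]_e \sum_(j < N)
      N%:R^-1%:E * (enorm (tnth (x e) j) ^+ 2)%:E)%E).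
    apply: ge0_le_integral => //.
    + by move=> e _; rewrite lee_fin sqr_ge0.
    + apply/measurable_EFinP; apply: measurable_funX.
      exact: mU'.
    + apply: emeasurable_sum => j; apply: measurable_funeM.
      by apply/measurable_EFinP; exact: measurable_funX.
    + move=> e _; under eq_bigr do rewrite -EFinM.
      rewrite sumEFin lee_fin -mulr_sumr /U' -[X in X%:R^-1](card_ord N).
      by apply: sqr_mean_le; rewrite card_ord.
  rewrite ge0_integral_sum//; last 2 first.
  - by move=> j; apply: measurable_funeM; apply/measurable_EFinP; exact: measurable_funX.
  - by move=> j e _; rewrite mule_ge0 ?lee_fin ?invr_ge0 ?sqr_ge0.
  apply: (@le_trans _ _ (\sum_(j < N) N%:R^-1%:E * (m n)%:E)%E).
    apply: lee_sum => j _; rewrite ge0_integralZl//.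
    + by rewrite lee_wpmul2l ?lee_fin ?invr_ge0//; exact: (coupled_moment xy).
    + by apply/measurable_EFinP; exact: measurable_funX.
    + by move=> e _; rewrite lee_fin sqr_ge0.
  rewrite sumEFin lee_fin sumr_const card_ord -[_ * _ *+ N]mulr_natl mulVKf//.
  by rewrite pnatr_eq0 -lt0n.
- rewrite (same_law_integral (f := fun z => (enorm (noise_row z) ^+ 2)%:E) _ _
    (pow_prob_coord noise i))//; first exact: measurable_tnth.
  apply/measurable_EFinP; apply: measurable_funX.
  exact: measurable_fun_enorm measurable_noise_row.
Qed.

Lemma coupled_step : exists d1 (E1 : measurableType d1) (Q1 : probability E1 R)
  (x1 y1 : E1 -> N.-tuple Rd), coupled n.+1 Q1 x1 y1.
Proof.
exists _, _, (Q \x pow_prob noise N)%E, (next Dx), (next Dy); split => //.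
- exact: mnext.
- exact: mnext.
Qed.

End step.

Lemma coupled_exists n : exists d0 (E : measurableType d0) (Q : probability E R)
  (x y : E -> N.-tuple Rd), coupled n Q x y.
Proof.
elim: n => [|n [d0 [E [Q [x [y xy]]]]]]; last exact: coupled_step xy.
by exists _, _, (pow_prob (eta 0%N) N), id, id; exact: coupled0.
Qed.

Lemma particle_second_moment n i :
  (\int[P]_w (enorm (X n i w) ^+ 2)%:E <= (m n)%:E)%E.
Proof.
have [d0 [E [Q [x [y xy]]]]] := coupled_exists n.
apply: le_trans (coupled_moment xy i).
pose f (t : N.-tuple Rd) := (enorm (tnth t i) ^+ 2)%:E.
have mf : measurable_fun setT f.
  exact: (measurableT_comp msq (@measurable_tnth _ Rd N i)).
rewrite (_ : (fun w => _) = (fun w => f (config X n w))).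
  by rewrite -(same_law_integral (coupled_mx xy) (measurable_config n) (coupled_lawx xy) mf).
by apply/funext => w; rewrite /f tnth_mktuple.
Qed.

Section first_particles.
Context {q : nat} (hq : (q <= N)%N).

Let first d3 (T : measurableType d3) (t : N.-tuple T) : q.-tuple T :=
  [tuple tnth t (widen_ord hq i) | i < q].

Let mfirst d3 (T : measurableType d3) : measurable_fun setT (@first d3 T).
Proof.
apply/measurable_fun_tnthP => i.
rewrite (_ : _ \o _ = fun t : N.-tuple T => tnth t (widen_ord hq i)).
  exact: measurable_tnth.
by apply/funext => t /=; rewrite tnth_mktuple.
Qed.

Lemma pow_prob_first d3 (T : measurableType d3) (mu : probability T R) :
  same_law (pow_prob mu N) (pow_prob mu q) (@first d3 T) id.
Proof.
apply: same_law_box => //; first exact: mfirst.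
move=> B mB; rewrite preimage_id [RHS]pow_prob_box//.
(* The box is padded with full sides beyond q; indexing by nat lets one family serve both
   products. *)
pose C (j : nat) := if insub j is Some i then B i else setT.
have CE (i : 'I_q) : C i = B i by rewrite /C valK.
have mC j : measurable (C j) by rewrite /C; case: insub.
have -> : @first d3 T @^-1` box B = box (fun i : 'I_N => C i).
  apply/seteqP; split => t h i.
    rewrite /C; case: insubP => [j _ ji|//].
    have := h j; rewrite tnth_mktuple; suff -> : widen_ord hq j = i by [].
    exact/val_inj.
  by rewrite tnth_mktuple -CE; exact: (h (widen_ord hq i)).
rewrite pow_prob_box//.
under [RHS]eq_bigr do rewrite -CE.
rewrite (big_ord_widen N (fun j => mu (C j)) hq) [RHS]big_mkcond/=.
apply: eq_bigr => i _; case: ifPn => // iq.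
by rewrite /C insubN//; exact: probability_setT.
Qed.

(** The coupling of all N particles is restricted to the first q. The norm on tuples is at most the
    sum of the q distances, whence the linear factor q. *)
Lemma W1_first_particles n :
  (W1 (@edist_tuple R d q) (pushforward P (first_particles X hq n))
      (pow_prob (eta n) q) <= (q%:R * (u n / Num.sqrt N%:R))%:E)%E.
Proof.
have [d0 [E [Q [x [y xy]]]]] := coupled_exists n.
pose x' e := @first _ Rd (x e); pose y' e := @first _ Rd (y e).
have mx' : measurable_fun setT x' by exact: (measurableT_comp (@mfirst _ Rd) (coupled_mx xy)).
have my' : measurable_fun setT y' by exact: (measurableT_comp (@mfirst _ Rd) (coupled_my xy)).
have mti i : measurable_fun setT (fun z : q.-tuple Rd * q.-tuple Rd =>
    edist (tnth z.1 i) (tnth z.2 i)).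
  apply: measurable_fun_enorm; apply: measurable_fun_rowB.
    exact: (measurableT_comp (@measurable_tnth _ Rd q i) measurable_fst).
  exact: (measurableT_comp (@measurable_tnth _ Rd q i) measurable_snd).
have md : measurable_fun setT
    (fun z : q.-tuple Rd * q.-tuple Rd => edist_tuple z.1 z.2).
  apply: measurableT_comp; first exact: (continuous_measurable_fun (@sqrt_continuous R)).
  by apply: measurable_sum => i; exact: measurable_funX.
apply: le_trans (W1_le mx' my' md _ _ _) _.
- by move=> ? ?; exact: sqrtr_ge0.
- move=> A mA; rewrite /x' /pushforward.
  have mA' : measurable (@first _ Rd @^-1` A).
    by rewrite -[X in measurable X]setTI; exact: mfirst.
  rewrite [LHS](coupled_lawx xy mA'); congr (P (_ @^-1` A)).
  apply/funext => w; apply: eq_from_tnth => i.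
  by rewrite !tnth_mktuple.
- move=> A mA; have mA' : measurable (@first _ Rd @^-1` A).
    by rewrite -[X in measurable X]setTI; exact: mfirst.
  by rewrite [LHS](coupled_lawy xy mA') preimage_id [LHS](pow_prob_first (eta n) mA).
have mdi i : measurable_fun setT (fun e => edist (tnth (x' e) i) (tnth (y' e) i)).
  exact: (measurableT_comp (mti i) (measurable_fun_pair mx' my')).
apply: (@le_trans _ _ (\int[Q]_e \sum_(i < q) (edist (tnth (x' e) i) (tnth (y' e) i))%:E)%E).
  apply: ge0_le_integral => //.
  - by move=> e _; rewrite lee_fin sqrtr_ge0.
  - by apply/measurable_EFinP; exact: (measurableT_comp md (measurable_fun_pair mx' my')).
  - by apply: emeasurable_sum => i; exact/measurable_EFinP.
  - by move=> e _; rewrite sumEFin lee_fin edist_tuple_le_sum.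
rewrite ge0_integral_sum//; last 2 first.
- by move=> i; exact/measurable_EFinP.
- by move=> i e _; rewrite lee_fin edist_ge0.
apply: (@le_trans _ _ (\sum_(i < q) (u n / Num.sqrt N%:R)%:E)%E).
  apply: lee_sum => i _; apply: le_trans (coupled_dist xy (widen_ord hq i)).
  by under eq_integral do rewrite !tnth_mktuple.
by rewrite sumEFin sumr_const card_ord mulr_natl.
Qed.

End first_particles.

End coupled_chain.

(** * Inequalities between the constants *)

Section constants.
Context {R : realType}.

Lemma edist_const_mx_gt0 d : (0 < d)%N -> 0 < edist (const_mx 1 : 'rV[R]_d) 0.
Proof.
move=> d0; rewrite lt_def edist_ge0 andbT.
apply/eqP => /enorm_eq0 /rowP /(_ (Ordinal d0)).
by rewrite !mxE subr0 => /eqP; rewrite oner_eq0.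
Qed.

Lemma elipschitz_ge0 d (C : R) (f : 'rV[R]_d -> 'rV[R]_d) :
  (0 < d)%N -> elipschitz C f -> 0 <= C.
Proof.
move=> d0 fC; have x0 := edist_const_mx_gt0 d0; set x := const_mx 1 in x0.
by rewrite -(pmulr_lge0 _ x0) (le_trans _ (fC x 0))// edist_ge0.
Qed.

(** Cauchy-Schwarz compares the monotonicity and the Lipschitz bound along one nonzero vector. The
    resulting upper bound on l is what limits delta in [step_contraction_lt1]. *)
Lemma hess_ge_le_lipschitz d (V : 'rV[R]_d -> R) (l C : R) : (0 < d)%N ->
  twice_differentiable V -> (forall x, mx_ge (hess V x) l) -> elipschitz C (grad V) ->
  l <= C.
Proof.
move=> d0 dV hV VC; have x0 := edist_const_mx_gt0 d0; set x := const_mx 1 in x0.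
have x20 : 0 < edist x 0 ^+ 2 by rewrite exprn_gt0.
rewrite -(ler_pM2r x20) (le_trans (hess_ge_monotone dV hV x 0))//.
rewrite (le_trans (dot_le_enorm _ _))// expr2 mulrA mulrC ler_wpM2r ?edist_ge0//.
exact: VC.
Qed.

(** The claim is r < (1 - delta CW)^2 together with delta CW < 1, which legitimates taking square
    roots. The first follows from the lower bound on l contained in the hypothesis, the second from
    playing that lower bound against l <= CV + CW. *)
Lemma step_contraction_lt1 (delta l CV CW : R) :
  0 < delta -> 0 <= CV -> 0 <= CW -> l <= CV + CW ->
  1 + delta * (2 - 2 * l) + 4 * delta ^+ 2 * (CV ^+ 2 + CW ^+ 2)
    + delta * (2 + 4 * delta) * CW ^+ 2 < 1 ->
  0 < l /\
  Num.sqrt (1 - 2 * delta * l + delta ^+ 2 * (CV + CW) ^+ 2) + delta * CW < 1.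
Proof.
move=> de0 CV0 CW0 lC h.
(* The hypothesis divided by 2 delta. *)
have {}h : 1 + 2 * delta * (CV ^+ 2 + CW ^+ 2) + (1 + 2 * delta) * CW ^+ 2 < l.
  rewrite -(ltr_pM2l (_ : 0 < 2 * delta)) ?mulr_gt0//; nra.
have V2 := sqr_ge0 CV; have W2 := sqr_ge0 CW.
have dV2 : 0 <= delta * CV ^+ 2 by rewrite mulr_ge0// ltW.
have dW2 : 0 <= delta * CW ^+ 2 by rewrite mulr_ge0// ltW.
have l0 : 0 < l by apply: lt_trans h; nra.
split => //.
have C2 : (CV + CW) ^+ 2 <= 2 * (CV ^+ 2 + CW ^+ 2).
  by have := sqr_ge0 (CV - CW); nra.
have dC2 := ler_wpM2l (ltW de0) C2.
have de2 : delta ^+ 2 * (CV + CW) ^+ 2 <= 2 * delta ^+ 2 * (CV ^+ 2 + CW ^+ 2).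
  rewrite [leRHS](_ : _ = delta ^+ 2 * (2 * (CV ^+ 2 + CW ^+ 2))); last by ring.
  by rewrite ler_wpM2l ?sqr_ge0.
have dW1 : delta * CW < 1.
  have hC : 1 + delta * (CV + CW) ^+ 2 + CW ^+ 2 < CV + CW.
    apply: lt_le_trans lC; apply: le_lt_trans h.
    by move: dC2 dV2 dW2; move: (CV ^+ 2) (CW ^+ 2) ((CV + CW) ^+ 2) => *; nra.
  (* By [hC], the polynomial delta S^2 - S + 1 + CW^2 is negative at S = CV + CW, so its
     discriminant is positive. *)
  have hd : 4 * delta * (1 + CW ^+ 2) < 1.
    have := sqr_ge0 (2 * delta * (CV + CW) - 1).
    by rewrite -(ltr_pM2l de0) in hC; nra.
  by have := mulr_ge0 (ltW de0) (sqr_ge0 (CW - 1)); nra.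
rewrite -ltrBrDr -[ltRHS]ger0_norm ?subr_ge0 ?(ltW dW1)// -sqrtr_sqr.
rewrite ltr_sqrt ?exprn_gt0 ?subr_gt0//.
(* 2 delta CW <= delta (1 + CW^2) pays for the cross term of (1 - delta CW)^2. *)
have := mulr_ge0 (ltW de0) (sqr_ge0 (CW - 1)).
have dW0 : 0 <= delta * CW by rewrite mulr_ge0// ltW.
have := sqr_ge0 (delta * CV); have := sqr_ge0 (delta * CW).
by rewrite -(ltr_pM2l de0) in h; nra.
Qed.

(** beta / (1 - rho) is the fixed point of the recursion; adding the initial value to it gives a
    bound that the recursion preserves. *)
Lemma affine_rec_bounded (rho beta : R) (x : nat -> R) :
  0 <= rho < 1 -> 0 <= beta -> 0 <= x 0%N ->
  (forall n, x n.+1 <= rho * x n + beta) ->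
  forall n, x n <= x 0%N + beta / (1 - rho).
Proof.
move=> /andP[rho0 rho1] beta0 x0 xS; have r1 : 0 < 1 - rho by rewrite subr_gt0.
have bE : beta = (1 - rho) * (beta / (1 - rho)) by rewrite mulrC divfK// gt_eqF.
have b0 : 0 <= beta / (1 - rho) by rewrite divr_ge0// ltW.
elim=> [|n ih]; first by rewrite lerDl.
apply: (le_trans (xS n)); rewrite {1}bE; move: (beta / _) b0 ih => t t0 ih.
have := ler_wpM2l rho0 ih; have := ler_wpM2r x0 (ltW rho1); nra.
Qed.

Lemma powR_inv_le_sqrt (N d : nat) : (0 < N)%N -> (2 <= d)%N ->
  N%:R `^ d%:R^-1 <= Num.sqrt N%:R :> R.
Proof.
move=> N0 d2; rewrite -powR12_sqrt ?ler0n// ler_powR ?ler1n//.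
by rewrite lef_pV2 ?posrE ?ltr0n// ?ler_nat// (leq_trans _ d2).
Qed.

End constants.

Theorem theorem4p2 (R : realType) (d : nat) (hd : (3 <= d)%N) :
  exists C2d : R,
  forall (delta : R) (V W : 'rV[R]_d -> R) (lV lW CV CW : R),
  0 < delta ->
  twice_differentiable V -> twice_differentiable W ->
  (forall x, mx_ge (hess V x) lV) -> (forall x, mx_ge (hess W x) lW) ->
  elipschitz CV (grad V) -> elipschitz CW (grad W) ->
  (forall x, W (- x) = W x) ->
  let K := em_kernel delta V W in
  (tau1 K <= (Num.sqrt (1 - 2 * delta * (lV + lW) + delta ^+ 2 * (CV + CW) ^+ 2)
              + Num.sqrt 2 * delta * CW)%:E < +oo)%E /\
  forall eta : nat -> probability 'rV[R]_d R,
  mean_field_dynamics K eta ->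
  (\int[eta 0%N]_x (enorm x ^+ 2)%:E < +oo)%E ->
  (exists M : nat -> R,
     forall (N : nat) (hN : (0 < N)%N) (d' : measure_display)
       (Omega : measurableType d') (P : probability Omega R)
       (X : nat -> 'I_N -> {RV P >-> 'rV[R]_d}),
     particle_dynamics X K (eta 0%N) ->
     (forall n : nat,
        ('E_P[fun w => (enorm (X n (Ordinal hN) w) ^+ 2)%R] <= (M n)%:E)%E) /\
     (forall (n q : nat) (hq : (q <= N)%N), (1 <= n)%N -> (1 <= q)%N ->
        (W1 (@edist_tuple R d q) (pushforward P (first_particles X hq n))
            (pow_prob (eta n) q)
         <= (C2d * (q%:R / N%:R `^ d%:R^-1))%:E *
            \sum_(0 <= k < n.+1) (Num.sqrt (M k))%:E * tau1 K ^+ (n - k))%E)) /\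
  (let a := 1 + delta * (2 - 2 * (lV + lW))
            + 4 * delta ^+ 2 * (CV ^+ 2 + CW ^+ 2) in
   let b := delta * (2 + 4 * delta) * CW ^+ 2 in
   (tau1 K < 1)%E -> a + b < 1 ->
   0 < lV + lW /\
   exists C' : R,
     forall (N : nat) (d' : measure_display)
       (Omega : measurableType d') (P : probability Omega R)
       (X : nat -> 'I_N -> {RV P >-> 'rV[R]_d}),
     particle_dynamics X K (eta 0%N) ->
     forall (n q : nat) (hq : (q <= N)%N), (1 <= n)%N -> (1 <= q)%N ->
       (W1 (@edist_tuple R d q) (pushforward P (first_particles X hq n))
           (pow_prob (eta n) q)
        <= (C' * q%:R / N%:R `^ d%:R^-1)%:E)%E).

Proof.
exists 1 => delta V W lV lW CV CW delta0 dV dW hV hW LV LW _ K.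
have d0 : (0 < d)%N by rewrite (leq_trans _ hd).
have CV0 := elipschitz_ge0 d0 LV; have CW0 := elipschitz_ge0 d0 LW.
set r := 1 - 2 * delta * (lV + lW) + delta ^+ 2 * (CV + CW) ^+ 2.
have b0 : 0 <= delta * CW by rewrite mulr_ge0// ltW.
split.
  rewrite ltry andbT (le_trans (tau1_le delta0 dV dW hV hW LV LW CV0 CW0))//.
  (* The coupling gives the coefficient delta CW, and 1 <= sqrt 2. *)
  rewrite lee_fin lerD2l -mulrA ler_peMl// -[leLHS]sqrtr1 ler_wsqrtr//.
  by rewrite ler1n.
move=> eta eta_step eta0.
have tau0 : (0 <= tau1 K)%E by exact: tau1_ge0.
have [G0 G00 hG0] := @noise_second_moment R d.
have [ra [rb [k [ra0 rb0 _ rab abk]]]] := sqr_affine_le (sqrtr_ge0 r) b0.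
(* The quadratic inequality at (0, 0, 1). It makes the source of the moment recursion positive. *)
have k1 : 1 <= k.
  by have := abk 0 0 1; rewrite !mulr0 !add0r expr0n /= !mulr0 !add0r expr1n mulr1.
have k0 : 0 <= k by rewrite (le_trans _ k1).
(* Enlarged to be positive, so that [beta], and with it every [m n], is positive even if [ra + rb]
   vanishes. *)
pose G := G0 + 1.
have hG : (\int[noise]_z (enorm (@noise_row R d z) ^+ 2)%:E <= G%:E)%E.
  by rewrite (le_trans hG0)// lee_fin lerDl.
pose beta := moment_source (delta := delta) (V := V) (W := W) G k.
have beta0 : 0 < beta.
  rewrite /beta /moment_source mulr_gt0 ?(lt_le_trans _ k1)// ltr_wpDl//.
    by rewrite mulr_ge0// sqr_ge0.
  rewrite mulr_gt0 ?ltr_wpDl// mulr_gt0// exprn_gt0// sqrtr_gt0.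
  by rewrite mulr_gt0.
have [|m0 m00 m0E] := lty_bound _ eta0.
  by apply: integral_ge0 => x _; rewrite lee_fin sqr_ge0.
pose m n := iter n (fun t => (ra + rb) * t + beta) (m0 + 1).
have rho0 : 0 <= ra + rb by rewrite addr_ge0.
have m_gt0 n : 0 < m n.
  elim: n => [|n ih]; first by rewrite /m /= ltr_wpDl.
  by rewrite /m iterS -/(m n) ltr_wpDl// mulr_ge0// ltW.
have m_le n : (\int[eta n]_x (enorm x ^+ 2)%:E <= (m n)%:E)%E.
  elim: n => [|n ih]; first by rewrite m0E lee_fin /m /= lerDl.
  rewrite /m iterS -/(m n).
  exact: (second_moment_step delta0 dV dW hV hW LV LW CV0 CW0 hG ra0 rb0 k0 abk
    (m_gt0 n) (eta_step n) ih).
have mS n : m n.+1 = (ra + rb) * m n + beta by [].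
pose c := Num.sqrt r + delta * CW.
have c0 : 0 <= c by rewrite addr_ge0 ?sqrtr_ge0.
pose g n := delta * Num.sqrt (4 * CW ^+ 2 * m n + 1).
(* The two systems start from the same points, hence the value 0; [u] does not involve N. *)
pose fix u n := if n is n'.+1 then c * u n' + g n' else 0.
have uS n : u n.+1 = c * u n + delta * Num.sqrt (4 * CW ^+ 2 * m n + 1) by [].
have u_ge0 n : 0 <= u n.
  elim: n => [|n ih] //; rewrite uS addr_ge0// mulr_ge0 ?sqrtr_ge0//.
  exact: ltW.
have W1u N (N0 : (0 < N)%N) := W1_first_particles delta0 dV dW hV hW LV LW CV0 CW0 hG ra0 rb0 k0
  abk eta_step m_gt0 m_le mS (erefl : u 0%N = 0) uS N0.
have rate N q n : (0 < N)%N ->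
    q%:R * (u n / Num.sqrt N%:R) <= u n * q%:R / N%:R `^ d%:R^-1.
  move=> N0; rewrite mulrCA mulrA ler_wpM2l// ?mulr_ge0//.
  rewrite lef_pV2 ?posrE ?sqrtr_gt0 ?powR_gt0 ?ltr0n//.
  by rewrite powR_inv_le_sqrt// (leq_trans _ hd).
split.
  (* M may be any bound on the second moments, so it can absorb the constant of
     the coupling estimate through the last term of the sum. *)
  exists (fun n => Num.max (m n) (u n ^+ 2)) => N N0 d' Omega P X X_dyn; split.
    move=> n; rewrite unlock.
    apply: le_trans (particle_second_moment delta0 dV dW hV hW LV LW CV0 CW0 hG ra0
      rb0 k0 abk eta_step m_gt0 m_le mS (erefl : u 0%N = 0) uS N0 X_dyn n _) _.
    by rewrite lee_fin le_max lexx.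
  move=> n q hq n1 q1; apply: le_trans (W1u _ N0 _ _ _ _ X_dyn _ hq n) _.
  rewrite mul1r big_nat_recr//= subnn expe0 mule1.
  apply: (@le_trans _ _ ((q%:R / N%:R `^ d%:R^-1)%:E * (u n)%:E)%E).
    by rewrite -EFinM lee_fin (le_trans (rate N q n N0))// [leRHS]mulrC mulrA.
  apply: lee_wpmul2l; first by rewrite lee_fin divr_ge0// powR_ge0.
  apply: lee_paddl.
    by apply: sume_ge0 => j _; rewrite mule_ge0 ?lee_fin ?sqrtr_ge0// expe_ge0.
  rewrite lee_fin -[leLHS]ger0_norm// -sqrtr_sqr ler_wsqrtr//.
  by rewrite le_max lexx orbT.
move=> a b _ ab1.
have lC : lV + lW <= CV + CW.
  by apply: lerD; [exact: hess_ge_le_lipschitz hV LV|exact: hess_ge_le_lipschitz hW LW].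
(* [c1] says c < 1. The summands sqrt r and delta CW of this c, not the [a] and [b] of the theorem,
   are those to which [rab] applies, so the moment recursion contracts too. *)
have [l0 c1] := step_contraction_lt1 delta0 CV0 CW0 lC ab1.
split => //.
have mb : exists2 mm, 0 <= mm & forall n, m n <= mm.
  exists (m 0%N + beta / (1 - (ra + rb))).
    rewrite addr_ge0 ?(ltW (m_gt0 _))// divr_ge0 ?(ltW beta0)//.
    by rewrite subr_ge0 ltW// rab.
  apply: affine_rec_bounded; [by rewrite rho0 rab|exact: ltW|exact: ltW|by []].
have [mm mm0 mmP] := mb.
pose gg := delta * Num.sqrt (4 * CW ^+ 2 * mm + 1).
(* With m n replaced by its uniform bound the source is constant; as u starts at 0, only the fixed
   point remains. *)
have ub n : u n <= gg / (1 - c).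
  have := @affine_rec_bounded R c gg u; rewrite /= add0r; apply => //.
  - by rewrite c0.
  - by rewrite mulr_ge0 ?sqrtr_ge0// ltW.
  - move=> j; rewrite lerD2l ler_wpM2l ?(ltW delta0)// ler_wsqrtr// lerD2r.
    by rewrite ler_wpM2l// mulr_ge0// sqr_ge0.
exists (gg / (1 - c)) => N d' Omega P X X_dyn n q hq n1 q1.
have N0 : (0 < N)%N by rewrite (leq_trans q1).
apply: le_trans (W1u _ N0 _ _ _ _ X_dyn _ hq n) _.
rewrite lee_fin (le_trans (rate N q n N0))// ler_wpM2r ?invr_ge0 ?powR_ge0//.
by rewrite ler_wpM2r.
Qed.
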